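(* Let $H$ be an infinite dimensional complex Hilbert space, let $\mathcal{K}$ be the $C^\star$-algebra of compact operators on $H$, and let $A$ be a dense Fréchet subalgebra of $\mathcal{K}$. Assume that $A$ is spectral invariant in $\mathcal{K}$. If $E$ is any topologically irreducible Banach $A$-module and $F \subseteq E$ is any algebraically cyclic $A$-submodule of $E$, then $F$ is contained in a $\mathcal{K}$-module; that is, there exist a $\mathcal{K}$-module $G$ and an injective linear map $\iota \colon F \to G$ such that $\iota(a\eta) = a\,\iota(\eta)$ for all $a \in A$ and $\eta \in F$, where $A$ acts on $G$ through the inclusion $A \subseteq \mathcal{K}$.
   Context: All algebras and modules are over $\mathbb{C}$; modules are left modules, and algebras are not assumed unital. A dense Fréchet subalgebra $A$ of a $C^\star$-algebra $B$ is a (norm-)dense subalgebra $A \subseteq B$ equipped with a Fréchet space topology (complete, metrizable, locally convex) for which multiplication $A \times A \to A$ is jointly continuous and the inclusion $A \hookrightarrow B$ is continuous. $A$ is not assumed to be closed under the involution of $B$. $A$ is spectral invariant in $B$ if every $a \in A$ that is quasi-invertible in $B$ is quasi-invertible in $A$ (here $a$ is quasi-invertible in an algebra $C$ if there is $c \in C$ with $a + c - ac = a + c - ca = 0$). Equivalently, each element of $A$ has the same nonzero spectrum in $A$ as in $B$, where for a nonunital algebra spectra are computed in the algebra with unit adjoined. A Banach $A$-module is a Banach space $E$ with an $A$-module structure such that the action map $A \times E \to E$ is jointly continuous. It is topologically irreducible if $E \neq 0$ and the only closed $A$-invariant linear subspaces of $E$ are $0$ and $E$. An $A$-submodule $F$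 of $E$ is an $A$-invariant linear subspace, not necessarily closed. It is algebraically cyclic if there is a vector $\xi \in F$ (a cyclic vector) with $F = A\xi = \{a\xi : a \in A\}$; in particular $\xi \in A\xi$. A $\mathcal{K}$-module is understood algebraically: a complex vector space $G$ with a bilinear associative action of $\mathcal{K}$. An $A$-module is contained in a $\mathcal{K}$-module if it embeds algebraically, by an injective $A$-module map, in a $\mathcal{K}$-module regarded as an $A$-module by restriction. *)

(* Defs.v *)
From HB Require Import structures.
From mathcomp Require Import all_boot all_order all_algebra.
From mathcomp Require Import finmap.
From mathcomp Require Import all_classical all_reals all_analysis.
From mathcomp.real_closed Require Import complex.

Set Implicit Arguments.
Unset Strict Implicit.
Unset Printing Implicit Defensive.

Import Order.TTheory GRing.Theory Num.Theory.
Import numFieldNormedType.Exports.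

Local Open Scope classical_set_scope.
Local Open Scope ring_scope.
Local Open Scope complex_scope.

(* Associative algebras that need not have a unit. *)
HB.mixin Record Lmodule_isNuAlgebra (K : pzRingType) V
    & GRing.Lmodule K V := {
  numul : V -> V -> V ;
  numulA : associative numul ;
  numulDl : left_distributive numul +%R ;
  numulDr : right_distributive numul +%R ;
  numulZl : forall (k : K) x y, numul (k *: x) y = k *: numul x y ;
  numulZr : forall (k : K) x y, numul x (k *: y) = k *: numul x y
}.

#[short(type="nuAlgType")]
HB.structure Definition NuAlgebra (K : pzRingType) :=
  {V of Lmodule_isNuAlgebra K V & GRing.Lmodule K V}.

Notation "x ** y" := (numul x y) (at level 40, left associativity) : ring_scope.

Section quasi_inverse.
Context {K : pzRingType}.

Definition quasi_invertible (A : nuAlgType K) (a : A) :=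
  exists c : A, a + c - a ** c = 0 /\ a + c - c ** a = 0.

Definition spectral_invariant (A B : nuAlgType K) (j : A -> B) :=
  forall a : A, quasi_invertible (j a) -> quasi_invertible a.

Definition nualg_morphism (A B : nuAlgType K) (j : A -> B) :=
  linear j /\ {morph j : a b / a ** b}.

End quasi_inverse.

Definition metrizable (R : realType) (T : topologicalType) :=
  exists d : T -> T -> R,
    [/\ forall x y, d x y = 0 <-> x = y,
        forall x y, d x y = d y x,
        forall x y z, d x z <= d x y + d y z &
        forall x, nbhs x =
          filter_from [set e : R | 0 < e] (fun e => [set y | d x y < e])].

(* A tvsType carries a uniformity that is only required to induce the topology;
   completeness of a topological vector space refers to the translation-invariant
   one, hence the explicit Cauchy condition on differences. *)
Definition tvs_cauchy (K : numDomainType) (E : tvsType K) (F : set_system E) :=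
  forall U, nbhs (0 : E) U -> \forall x & y \near F, U (x - y).

HB.mixin Record isFrechetAlgebra (R : realType) A
    & Tvs R[i] A & NuAlgebra R[i] A := {
  frechet_metrizable : metrizable R A ;
  frechet_complete : forall F : set_system A, ProperFilter F ->
    tvs_cauchy F -> exists a : A, F --> a ;
  frechet_mul_continuous : continuous (fun p : A * A => p.1 ** p.2)
}.

#[short(type="frechetAlgType")]
HB.structure Definition FrechetAlgebra (R : realType) :=
  {A of isFrechetAlgebra R A & Tvs R[i] A & NuAlgebra R[i] A}.

Section compact_operators.
Context {R : realType} {V : normedModType R[i]}.
Implicit Types (S T : V -> V).

Definition compact_operator T :=
  linear T /\ precompact (T @` [set x | `|x| <= 1]).

Definition compact_operator_pred : {pred V -> V} :=
  mem [set T | compact_operator T].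

Lemma compact_operatorP T :
  reflect (compact_operator T) (T \in compact_operator_pred).
Proof. by apply: (iffP idP) => [/set_mem|/mem_set]. Qed.

Lemma compact_precompact (A B : set V) : A `<=` B -> compact B -> precompact A.
Proof.
move=> AB cB; exists B => //; split => //.
exact: compact_closed (@norm_hausdorff _ V) cB.
Qed.

Lemma compact_image_scale (k : R[i]) (A : set V) :
  compact A -> compact (( *:%R k) @` A).
Proof.
move=> cA; apply: continuous_compact => //.
apply: continuous_subspaceT => x; exact: scaler_continuous.
Qed.

Lemma submod_closed_compact_operator : submod_closed compact_operator_pred.
Proof.
split.
  apply/compact_operatorP; split; first by move=> a u v; rewrite /GRing.zero/= scaler0 addr0.
  apply: (@compact_precompact _ [set 0]); last exact: compact_set1.
  by move=> _ [x _ <-].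
move=> k S T /compact_operatorP[linS [CS SCS [cCS _]]].
move=> /compact_operatorP[linT [CT TCT [cCT _]]].
apply/compact_operatorP; split.
  move=> a u v; rewrite !fctE linS linT !scalerDr !scalerA addrACA.
  by rewrite [k * a]mulrC.
apply: (@compact_precompact _
  ((fun z : V * V => z.1 + z.2) @` ((( *:%R k) @` CS) `*` CT))).
  move=> _ [x xB <-]; exists (k *: S x, T x) => //; split => /=.
    by exists (S x) => //; apply: SCS; exists x.
  by apply: TCT; exists x.
apply: continuous_compact; last first.
  by apply: compact_setX => //; exact: compact_image_scale.
by apply: continuous_subspaceT => z; exact: add_continuous.
Qed.

HB.instance Definition _ := GRing.isSubmodClosed.Build R[i] (V -> V)
  compact_operator_pred submod_closed_compact_operator.

Lemma normcE (x : V) : `|x| = (complex.Re `|x|)%:C.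
Proof. by rewrite RRe_real// ger0_real. Qed.

Lemma compact_norm_bounded (A : set V) : compact A ->
  exists2 M : R, 0 < M & forall x, A x -> `|x| <= M%:C.
Proof.
rewrite compact_cover => Aco.
have /Aco : A `<=` \bigcup_(n : nat) [set p | `|p| < n%:R].
  move=> p _; exists (Num.truncn (complex.Re `|p|)).+1 => //=.
  by rewrite normcE -(rmorph_nat (real_complex R)) ltcR truncnS_gt.
case=> [n _|D _ DcovA].
  rewrite openE => p /=; rewrite -subr_gt0 => ltpn.
  apply/nbhs_ballP; exists (n%:R - `|p|) => // q.
  rewrite -ball_normE /= ltrBrDr distrC; apply: le_lt_trans.
  by rewrite -{1}(subrK p q) ler_normD.
exists (\sum_(i : D) (fsval i)%:R + 1).
  by rewrite ltr_wpDl// sumr_ge0.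
move=> x /DcovA[n Dn /= /ltW/le_trans]; apply.
rewrite -(rmorph_nat (real_complex R)) lecR.
rewrite (bigD1 [`Dn]%fset)//= -addrA lerDl addr_ge0// sumr_ge0//.
Qed.

Lemma compact_operator_comp S T :
  compact_operator S -> compact_operator T -> compact_operator (S \o T).
Proof.
move=> [linS [CS SCS [cCS _]]] [linT [CT TCT [cCT _]]]; split.
  by move=> a u v; rewrite /= linT linS.
have [M M0 CTM] := compact_norm_bounded cCT.
have MC0 : M%:C != 0 :> R[i] by rewrite gt_eqF// ltcR.
have linSZ : forall a u, S (a *: u) = a *: S u.
  move=> a u; have S0 : S 0 = 0.
    by have := linS (-1) 0 0; rewrite !scaleN1r oppr0 addr0 addNr.
  by rewrite -[a *: u]addr0 linS S0 addr0.
apply: (@compact_precompact _ (( *:%R M%:C) @` CS)).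
  move=> _ [x xB <-] /=; exists (S (M%:C^-1 *: T x)).
    apply: SCS; exists (M%:C^-1 *: T x) => //=.
    rewrite normrZ normfV ger0_norm ?lecR ?(ltW M0)//.
    rewrite ler_pdivrMl ?ltcR// mulr1.
    by apply: CTM; apply: TCT; exists x.
  by rewrite linSZ scalerA divff// scale1r.
exact: compact_image_scale.
Qed.

End compact_operators.

Section compop.
Context {R : realType}.

Record compop (V : normedModType R[i]) := Compop {
  compop_fun :> V -> V ;
  _ : compop_fun \in @compact_operator_pred R V
}.

End compop.

Section compop_lmodule.
Context {R : realType} {V : normedModType R[i]}.
Notation K := (compop V).

HB.instance Definition _ := [isSub for @compop_fun R V].
HB.instance Definition _ := [Choice of K by <:].
HB.instance Definition _ := [SubChoice_isSubLmodule of K by <:].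

Implicit Types (S T : K) (x y : V).

Lemma compopP T : compact_operator T.
Proof. by case: T => T TP; exact/compact_operatorP. Qed.

Lemma compop_eqP S T : S = T <-> S =1 T.
Proof. by split=> [->//|ST]; apply: val_inj; apply/funext. Qed.

Lemma compopD T k x y : T (k *: x + y) = k *: T x + T y.
Proof. by have [linT _] := compopP T; exact: linT. Qed.

Lemma compop0 T : T 0 = 0.
Proof. by have := compopD T (-1) 0 0; rewrite !scaleN1r oppr0 addr0 addNr. Qed.

Lemma compopZ T k x : T (k *: x) = k *: T x.
Proof. by have := compopD T k x 0; rewrite compop0 !addr0. Qed.

Lemma add_compopE S T x : (S + T) x = S x + T x. Proof. by []. Qed.
Lemma scale_compopE k T x : (k *: T) x = k *: T x. Proof. by []. Qed.
Lemma zero_compopE x : (0 : K) x = 0. Proof. by []. Qed.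

Lemma comp_compop_subproof S T : S \o T \in @compact_operator_pred R V.
Proof.
by apply/compact_operatorP/compact_operator_comp; exact: compopP.
Qed.

Definition comp_compop S T : K := Compop (comp_compop_subproof S T).

Lemma comp_compopA : associative comp_compop.
Proof. by move=> S T U; apply/compop_eqP. Qed.

Lemma comp_compopDl : left_distributive comp_compop +%R.
Proof. by move=> S T U; apply/compop_eqP. Qed.

Lemma comp_compopDr : right_distributive comp_compop +%R.
Proof.
move=> S T U; apply/compop_eqP => x /=.
by have := compopD S 1 (T x) (U x); rewrite !scale1r.
Qed.

Lemma comp_compopZl k S T : comp_compop (k *: S) T = k *: comp_compop S T.
Proof. by apply/compop_eqP. Qed.

Lemma comp_compopZr k S T : comp_compop S (k *: T) = k *: comp_compop S T.
Proof. by apply/compop_eqP => x /=; exact: compopZ. Qed.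

HB.instance Definition _ := Lmodule_isNuAlgebra.Build R[i] K
  comp_compopA comp_compopDl comp_compopDr comp_compopZl comp_compopZr.

Lemma mul_compopE S T x : (S ** T) x = S (T x). Proof. by []. Qed.

Definition opnorm T : R :=
  sup [set complex.Re `|T x| | x in [set x | `|x| <= 1]].

Lemma opnorm_has_sup T :
  has_sup [set complex.Re `|T x| | x in [set x | `|x| <= 1]].
Proof.
split; first by exists (complex.Re `|T 0|), 0 => //=; rewrite normr0 ler01.
have [_ [C TC [cC _]]] := compopP T.
have [M M0 CM] := compact_norm_bounded cC.
exists M => _ [x xB <-]; rewrite -lecR -normcE.
by apply: CM; apply: TC; exists x.
Qed.

Lemma opnorm_ub T x : `|x| <= 1 -> `|T x| <= (opnorm T)%:C.
Proof.
move=> x1; rewrite normcE lecR.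
by apply: (sup_upper_bound (opnorm_has_sup T)); exists x.
Qed.

Lemma opnorm_le T (M : R) :
  (forall x, `|x| <= 1 -> `|T x| <= M%:C) -> opnorm T <= M.
Proof.
move=> TM; apply: ge_sup; first by have [] := opnorm_has_sup T.
by move=> _ [x xB <-]; rewrite -lecR -normcE; exact: TM.
Qed.

Lemma opnorm_ge0 T : 0 <= opnorm T.
Proof.
by rewrite -lecR (le_trans (normr_ge0 (T 0)))// opnorm_ub// normr0 ler01.
Qed.

Lemma opnormP T x : `|T x| <= (opnorm T)%:C * `|x|.
Proof.
have [->|x0] := eqVneq x 0; first by rewrite compop0 !normr0 mulr0.
have nx : 0 < `|x| by rewrite normr_gt0.
rewrite -ler_pdivrMr// mulrC -[X in X * _](@ger0_norm _ `|x|^-1) ?invr_ge0//.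
by rewrite -normrZ -compopZ opnorm_ub// normfZV.
Qed.

Definition compop_norm T : R[i] := (opnorm T)%:C.

Lemma compop_normD S T : compop_norm (S + T) <= compop_norm S + compop_norm T.
Proof.
rewrite /compop_norm -rmorphD lecR; apply: opnorm_le => x x1.
by rewrite rmorphD (le_trans (ler_normD _ _))// lerD// opnorm_ub.
Qed.

Lemma compop_normZ k T : compop_norm (k *: T) = `|k| * compop_norm T.
Proof.
have le a U : compop_norm (a *: U) <= `|a| * compop_norm U.
  have aE : `|a| = (complex.Re `|a|)%:C by rewrite RRe_real// ger0_real.
  rewrite {1}aE /compop_norm -rmorphM lecR.
  apply: opnorm_le => x x1.
  by rewrite rmorphM/= -aE normrZ ler_wpM2l// opnorm_ub.
apply/eqP; rewrite eq_le le/=.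
have [->|k0] := eqVneq k 0.
  by rewrite normr0 mul0r lecR opnorm_ge0.
rewrite -{1}[T](scalerK k0) -ler_pdivlMl ?normr_gt0// -normfV.
exact: le.
Qed.

Lemma compop_norm0_eq0 T : compop_norm T = 0 -> T = 0.
Proof.
move=> T0; apply/compop_eqP => x; apply/normr0_eq0/eqP.
by rewrite eq_le normr_ge0 andbT (le_trans (opnormP T x))// -/(compop_norm T) T0 mul0r.
Qed.

HB.instance Definition _ := Lmodule_isNormed.Build R[i] K
  compop_normD compop_normZ compop_norm0_eq0.

Lemma compop_normE T : `|T| = (opnorm T)%:C.
Proof. by []. Qed.

End compop_lmodule.


Definition module_action (K : pzRingType) (A : nuAlgType K) (M : lmodType K)
    (act : A -> M -> M) :=
  [/\ forall x, linear (act^~ x),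
      forall a, linear (act a) &
      forall a b x, act (a ** b) x = act a (act b x)].

Definition submodule (K : pzRingType) (A : nuAlgType K) (M : lmodType K)
    (act : A -> M -> M) (F : set M) :=
  [/\ F 0, forall k x y, F x -> F y -> F (k *: x + y) &
      forall a x, F x -> F (act a x)].

Definition algebraically_cyclic (K : pzRingType) (A : nuAlgType K)
    (M : lmodType K) (act : A -> M -> M) (F : set M) :=
  exists2 xi, F xi & F = range (act^~ xi).

(* A linear map defined on the subspace F is represented by a function on the
   ambient space of which only the values on F matter. *)
Definition contained_in_module (K : pzRingType) (A B : nuAlgType K) (j : A -> B)
    (M : lmodType K) (act : A -> M -> M) (F : set M) :=
  exists (G : lmodType K) (actG : B -> G -> G) (iota : M -> G),
    [/\ module_action actG,
        forall k x y, F x -> F y -> iota (k *: x + y) = k *: iota x + iota y,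
        forall x y, F x -> F y -> iota x = iota y -> x = y &
        forall a x, F x -> iota (act a x) = actG (j a) (iota x)].

Section topological_modules.
Context {R : realType} {A : frechetAlgType R} {E : completeNormedModType R[i]}.

Definition banach_module (act : A -> E -> E) :=
  module_action act /\ continuous (fun p : A * E => act p.1 p.2).

Definition topologically_irreducible (act : A -> E -> E) :=
  (exists x : E, x != 0) /\
  forall F : set E, submodule act F -> closed F -> F = [set 0] \/ F = setT.

End topological_modules.

(* H is a Hilbert space: its norm, which is complete, comes from the positive
   definite sesquilinear form dot. *)
Definition hilbert_norm (R : realType) (H : completeNormedModType R[i])
    (dot : {dot H for @Num.conj R[i]}) :=
  forall x : H, `|x| ^+ 2 = dot x x.

Definition finite_dimensional (K : pzRingType) (V : lmodType K) :=
  exists (n : nat) (e : 'I_n -> V),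
    forall x, exists c : 'I_n -> K, x = \sum_(i < n) c i *: e i.

Definition dense_frechet_subalgebra (R : realType) (H : normedModType R[i])
    (A : frechetAlgType R) (j : A -> compop H) :=
  [/\ nualg_morphism j, injective j, continuous j & dense (range j)].

(* Main.v *)
Require Import Defs.
From mathcomp Require Import all_boot all_order all_algebra.
From mathcomp Require Import all_classical all_reals all_analysis.
From mathcomp.real_closed Require Import complex.
From mathcomp Require Import ring.

(* Since A is spectral invariant, the elements [a] with [`|j a| < 1] are quasi-invertible,
   and completeness makes the quasi-inverse continuous at 0, hence resolvents are
   continuous. Riesz projections are therefore limits in A of Riemann sums of resolvents;
   applied to an element of A close to a rank one projection they yield [r] in A with
   [j r] of rank one, say [j r x = f x *: u]. The ideal [A r A] is norm dense in the
   compact operators.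

   Let [F = A xi] with [xi = e xi] nonzero, and choose [rho] in [A r A] with
   [`|j (e - rho)| < 1]. Then [xi = (1 - (e - rho))^-1 rho xi] lies in [A r E]. As
   [r a r = f (a u) r], topological irreducibility shows that [r E] is a line [C eta],
   so [xi = c eta] for some [c] in A. Finally [a eta = 0] iff [j a u = 0], so
   [a xi |-> j a (j c u)] is a well-defined injection of F into the module H. *)

Set Implicit Arguments.
Unset Strict Implicit.
Unset Printing Implicit Defensive.

Import Order.TTheory GRing.Theory Num.Theory.
Import numFieldNormedType.Exports.

Local Open Scope classical_set_scope.
Local Open Scope ring_scope.
Local Open Scope complex_scope.


(** * Quasi-inverses *)
Section nualgebra.
Context {K : pzRingType} {A : nuAlgType K}.
Implicit Types (a b c x y z : A) (k : K).

(** Spectral invariance yields quasi-inverses in [A] but no control of them in the topology of [A],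
    where multiplication is merely jointly continuous and a Neumann series may diverge; hence the
    detour through completeness. Contour calculus is replaced by an exact identity: the mean of
    [(1 - w z)^-1] over the roots of unity [w] of order [2^m] is [(1 - z^(2^m))^-1]. Every Riemann
    sum is thus itself a quasi-inverse, and relations between the limits come from algebraic
    identities valid for each [m]. Since [1 - c = (1 - a)^-1] for a quasi-inverse [c] of [a], the
    sums tend to the projection for the eigenvalues outside a circle. [A] need not be closed under
    the involution, so this projection need not be orthogonal; its rank is found by comparing it in
    norm with an orthogonal projection [p0], using two circles that both separate the eigenvalue 4
    of [4 p0] from 0. *)

Lemma numul0r x : 0 ** x = 0.
Proof. by rewrite -[X in X ** _](scale0r x) numulZl scale0r. Qed.

Lemma numulr0 x : x ** 0 = 0.
Proof. by rewrite -[X in _ ** X](scale0r x) numulZr scale0r. Qed.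

Lemma numulNl x y : (- x) ** y = - (x ** y).
Proof. by rewrite -!scaleN1r numulZl. Qed.

Lemma numulNr x y : x ** (- y) = - (x ** y).
Proof. by rewrite -!scaleN1r numulZr. Qed.

Lemma numulBl x y z : (x - y) ** z = x ** z - y ** z.
Proof. by rewrite numulDl numulNl. Qed.

Lemma numulBr x y z : x ** (y - z) = x ** y - x ** z.
Proof. by rewrite numulDr numulNr. Qed.

Lemma numul_suml (I : Type) (s : seq I) (F : I -> A) y :
  (\sum_(i <- s) F i) ** y = \sum_(i <- s) F i ** y.
Proof.
elim: s => [|i s IH]; first by rewrite !big_nil numul0r.
by rewrite !big_cons numulDl IH.
Qed.

Lemma numul_sumr (I : Type) (s : seq I) (F : I -> A) y :
  y ** (\sum_(i <- s) F i) = \sum_(i <- s) y ** F i.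
Proof.
elim: s => [|i s IH]; first by rewrite !big_nil numulr0.
by rewrite !big_cons numulDr IH.
Qed.

(* In the unitization, [1 - circ x y = (1 - x)(1 - y)]. *)
Definition circ x y := x + y - x ** y.

Lemma circ0l x : circ 0 x = x.
Proof. by rewrite /circ numul0r add0r subr0. Qed.

Lemma circ0r x : circ x 0 = x.
Proof. by rewrite /circ numulr0 addr0 subr0. Qed.

Lemma circA : associative circ.
Proof.
move=> x y z; rewrite /circ !numulBl !numulBr !numulDl !numulDr numulA.
rewrite !opprD !opprK !addrA.
by rewrite (ACl (1*2*5*3*6*4*7)%AC).
Qed.

Definition qinv a c := circ a c = 0 /\ circ c a = 0.

Lemma qinvC a c : qinv a c -> qinv c a. Proof. by case. Qed.

Lemma quasi_invertibleP a : quasi_invertible a <-> exists c, qinv a c.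
Proof.
by split=> -[c]; rewrite /qinv /circ => -[h1 h2]; exists c; split; rewrite // [c + a]addrC in h2 *.
Qed.

Lemma qinv_uniq a b c : circ b a = 0 -> circ a c = 0 -> b = c.
Proof. by move=> h1 h2; rewrite -[b]circ0r -h2 circA h1 circ0l. Qed.

Lemma qinv_circ a a' b b' : qinv a a' -> qinv b b' -> qinv (circ a b) (circ b' a').
Proof.
move=> [h1 h2] [h3 h4]; split.
  by rewrite -circA [circ b _]circA h3 circ0l.
by rewrite -circA [circ a' _]circA h2 circ0l.
Qed.

Lemma qinv_mull a c : qinv a c -> a ** c = a + c.
Proof. by move=> [+ _] => /eqP; rewrite subr_eq0 => /eqP. Qed.

Lemma qinv_mulr a c : qinv a c -> c ** a = a + c.
Proof. by move=> /qinvC/qinv_mull; rewrite addrC. Qed.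

Lemma mul_qinv a c : a ** c = a + c -> c ** a = a + c -> qinv a c.
Proof. by rewrite /qinv /circ => -> ->; rewrite [c + a]addrC subrr. Qed.

(* Partial fractions: [2 / (1 - w^2) = 1 / (1 - w) + 1 / (1 + w)]. *)
Lemma qinv_sqr w c d k : k + k = 1 -> qinv w c -> qinv (- w) d ->
  qinv (w ** w) (k *: (c + d)).
Proof.
move=> kk wc wd.
have kz z : k *: (z + z) = z by rewrite scalerDr -scalerDl kk scale1r.
have wdE : w ** d = w - d.
  by apply/oppr_inj; rewrite -numulNl (qinv_mull wd) opprB addrC.
have dwE : d ** w = w - d.
  by apply/oppr_inj; rewrite -numulNr (qinv_mulr wd) opprB addrC.
apply: mul_qinv.
  rewrite numulZr numulDr -!numulA (qinv_mull wc) wdE numulBr wdE numulDr (qinv_mull wc).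
  rewrite -[in RHS](kz (w ** w)) -scalerDr; congr (_ *: _).
  by rewrite opprB !addrA (ACl (1*4*3*5*2*6)%AC) /= addrK.
rewrite numulZl numulDl !numulA (qinv_mulr wc) dwE numulBl dwE numulDl (qinv_mulr wc).
rewrite -[in RHS](kz (w ** w)) -scalerDr; congr (_ *: _).
by rewrite opprB !addrA (ACl (1*4*3*5*2*6)%AC) /= addrK.
Qed.

(** With [1 - p = (1 - x)^-1] and [1 - q = (1 - k x)^-1], both sides equal
    [- k x (1 - x)^-1 (1 - k x)^-1]. As [k] tends to 0 this makes [(1 - p) q] vanish in the limit,
    which relates the projections of two circles. *)
Lemma qinv_scale_commute k x p q : qinv x p -> qinv (k *: x) q ->
  q - p ** q = k *: (p - p ** q).
Proof.
move=> xp xq.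
have e1 : k *: (x ** q) = k *: x + q by rewrite -numulZl (qinv_mull xq).
have e2 : p ** x = x + p by exact: qinv_mulr.
have e3 : p ** q - k *: (p ** q) = q - k *: p.
  apply/(canLR (subrK _)).
  have {1}-> : q = k *: (x ** q) - k *: x by rewrite e1 [_ + q]addrC addrK.
  rewrite numulBr !numulZr numulA e2 numulDl scalerDr e1 scalerDr.
  by rewrite opprD opprK !addrA (ACl (2*5*3*1*4)%AC) /= addrK.
have : q - k *: p + k *: p - p ** q = k *: (p - p ** q).
  by rewrite -e3 scalerBr (ACl (3*2*1*4)%AC) /= addrK.
by rewrite subrK.
Qed.

End nualgebra.


(** * Continuity of the quasi-inverse in a Frechet algebra *)
Section frechet.
Context {R : realType} {A : frechetAlgType R}.
Implicit Types (a b x y z : A) (U V W : set A) (u : nat -> A).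

Lemma nbhs0_half U : nbhs (0 : A) U ->
  exists2 W, nbhs (0 : A) W & forall x y, W x -> W y -> U (x + y).
Proof.
move=> U0; have /= := @add_continuous A (0, 0) U; rewrite addr0 => /(_ U0)[[W1 W2]/= [h1 h2] hU].
exists (W1 `&` W2); first exact: filterI.
by move=> x y [? _] [_ ?]; exact: (hU (x, y)).
Qed.

Lemma nbhs0_shift a U : nbhs a U <-> nbhs (0 : A) [set x | U (x + a)].
Proof.
have key b c W : nbhs (b + c) W -> nbhs b [set x | W (x + c)].
  have /= := @add_continuous A (b, c) W => h /h[[W1 W2]/= [h1 h2] hW].
  by apply: filterS h1 => x ?; apply: (hW (x, c)); split => //=; exact: nbhs_singleton.
split=> [aU|]; first by apply: key; rewrite add0r.
rewrite -[X in _ -> nbhs X _](add0r a) => h; rewrite add0r.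
have := key a (- a) [set x | U (x + a)]; rewrite subrr => /(_ h).
by apply: filterS => x /=; rewrite subrK.
Qed.

Lemma cvg_seqP u a : u @ \oo --> a <->
  forall U, nbhs (0 : A) U -> exists N, forall n, (N <= n)%N -> U (u n - a).
Proof.
split=> [ua U U0|h W /nbhs0_shift/h[N hN]].
  have /ua [N _ hN] : nbhs a [set x | U (x - a)].
    by apply/nbhs0_shift; apply: filterS U0 => x /=; rewrite addrK.
  by exists N => n /hN.
by exists N => // n /hN /=; rewrite subrK.
Qed.

Lemma frechet_cauchy_cvg u :
  (forall U, nbhs (0 : A) U -> exists N, forall m n, (N <= m)%N -> (N <= n)%N -> U (u m - u n)) ->
  exists a, u @ \oo --> a.
Proof.
move=> h; apply: frechet_complete => U /h[N hN].
exists ([set x | exists2 m, (N <= m)%N & x = u m], [set x | exists2 m, (N <= m)%N & x = u m]) => /=.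
  by split; exists N => // n Nn /=; exists n.
by move=> [x y] /= [[m Nm ->] [n Nn ->]]; exact: hN.
Qed.

(** The metric need not be translation invariant. Halving neighbourhoods repeatedly, and
    intersecting each with a ball around 0, gives a countable base in which errors can be summed. *)
Lemma frechet_base : exists V : nat -> set A,
  [/\ forall n, nbhs (0 : A) (V n),
      forall W, nbhs (0 : A) W -> exists n, V n `<=` W &
      forall n x y, V n.+1 x -> V n.+1 y -> V n (x + y)].
Proof.
have [d [_ _ _ dE]] := @frechet_metrizable R A.
have half U : exists W, nbhs (0 : A) U ->
    nbhs (0 : A) W /\ forall x y, W x -> W y -> U (x + y).
  have [/nbhs0_half[W ? ?]|?] := pselect (nbhs (0 : A) U); first by exists W.
  by exists setT.
have [hf hfP] := choice half.
pose U n := [set y | d 0 y < n.+1%:R^-1].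
have nU n : nbhs (0 : A) (U n) by rewrite dE; exists (n.+1%:R^-1) => //=.
pose V := fix V n := if n is m.+1 then hf (V m) `&` U n else U 0%N.
have nV n : nbhs (0 : A) (V n).
  by elim: n => [|n IH] /=; [exact: nU|apply: filterI => //; have [] := hfP _ IH].
exists V; split => //.
- move=> W; rewrite dE => -[e /= e0 eW]; exists (Num.truncn e^-1).+1 => y [_ Uy].
  apply: eW => /=; apply: (lt_trans Uy); rewrite invf_plt ?posrE//.
  by apply: lt_trans (truncnS_gt _) _; rewrite ltr_nat.
- by move=> n x y [hx _] [hy _]; have [_] := hfP _ (nV n); exact.
Qed.

Lemma seq_telescope_base (V : nat -> set A) u k m :
  (forall n, nbhs (0 : A) (V n)) ->
  (forall n x y, V n.+1 x -> V n.+1 y -> V n (x + y)) ->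
  (forall n, (m <= n)%N -> (n < m + k)%N -> V n.+1 (u n.+1 - u n)) -> V m (u (m + k)%N - u m).
Proof.
move=> V0 VD; elim: k m => [|k IH] m h.
  by rewrite addn0 subrr; exact: nbhs_singleton.
rewrite -[u _](subrK (u m.+1)) -addrA; apply: VD.
  rewrite addnS -addSn; apply: IH => n mn nk; apply: h; first exact: ltnW.
  by rewrite addnS -addSn.
by apply: h => //; rewrite addnS ltnS leq_addr.
Qed.

(** Increments in [V n.+2] keep all later differences in [V n.+1]; the second index is spent on
    passing to the limit, since [V n] need not be closed. *)
Lemma frechet_telescope_cvg (V : nat -> set A) u m0 :
  (forall n, nbhs (0 : A) (V n)) ->
  (forall W, nbhs (0 : A) W -> exists n, V n `<=` W) ->
  (forall n x y, V n.+1 x -> V n.+1 y -> V n (x + y)) ->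
  (forall n, (m0 <= n)%N -> V n.+2 (u n.+1 - u n)) ->
  exists2 a, u @ \oo --> a & forall n, (m0 <= n)%N -> V n (a - u n).
Proof.
move=> V0 VW VD Vu.
have tel n k : (m0 <= n)%N -> V n.+1 (u (n + k)%N - u n).
  move=> m0n; apply: (@seq_telescope_base (fun n => V n.+1)) => [//|i x y|i ni _].
    exact: VD.
  by apply: Vu; exact: leq_trans ni.
have [a ua] : exists a, u @ \oo --> a.
  apply: frechet_cauchy_cvg => U /nbhs0_half[W W0 WU].
  have [Z Z0 ZW] : exists2 Z, nbhs (0 : A) Z & forall x, Z x -> W x /\ W (- x).
    exists (W `&` -%R @^-1` W) => //; apply: filterI => //.
    by apply: (@opp_continuous A 0); rewrite oppr0.
  have [k kZ] := VW _ Z0.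
  pose N := maxn m0 k.
  have VZ : V N.+1 `<=` Z.
    have Vle i : V (i + k)%N `<=` V k.
      elim: i => [//|i IH] x Vx; apply: IH.
      by rewrite -[x]addr0; apply: VD => //; exact: nbhs_singleton.
    have kN : (k <= N.+1)%N by apply: leqW; exact: leq_maxr.
    by apply: subset_trans kZ; have := Vle (N.+1 - k)%N; rewrite subnK.
  have hN m : (N <= m)%N -> Z (u m - u N).
    by move=> /subnKC <-; apply: VZ; apply: tel; rewrite leq_maxl.
  exists N => m n Nm Nn; rewrite -(subrK (u N) (u m)) -addrA -[u N - u n]opprB; apply: WU.
    by have [] := ZW _ (hN _ Nm).
  by have [] := ZW _ (hN _ Nn).
exists a => // n m0n.
have /cvg_seqP : u @ \oo --> a by [].
have [W W0 WV] : exists2 W, nbhs (0 : A) W & forall x, W x -> V n.+1 (- x).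
  by exists (-%R @^-1` V n.+1) => //; apply: (@opp_continuous A 0); rewrite oppr0.
move=> /(_ _ W0)[N hN]; have := hN (n + N)%N (leq_addl _ _).
move=> /WV; rewrite opprB => h.
by rewrite -[a](subrK (u (n + N)%N)) -addrA; apply: VD => //; exact: tel.
Qed.

End frechet.


Section qinv_continuity.
Context {R : realType} {A : frechetAlgType R}.
Implicit Types (a b x y z : A) (U V W G : set A) (u : nat -> A).

Lemma cvg_seq_unique u a b : u @ \oo --> a -> u @ \oo --> b -> a = b.
Proof.
have [d [d0 dC dT dE]] := @frechet_metrizable R A.
move=> /cvg_seqP ua /cvg_seqP ub; apply/eqP; rewrite -subr_eq0; apply/eqP.
have in_nbhs U : nbhs (0 : A) U -> U (a - b).
  move=> /nbhs0_half[W W0 WU].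
  have /ua[N hN] : nbhs (0 : A) (-%R @^-1` W).
    by apply: (@opp_continuous A 0); rewrite oppr0.
  have /ub[M hM] := W0.
  have := WU _ _ (hN _ (leq_maxl N M)) (hM _ (leq_maxr N M)).
  by rewrite opprB addrA subrK.
apply/esym/d0/eqP; rewrite eq_le; apply/andP; split.
  rewrite leNgt; apply/negP => dgt0.
  have /in_nbhs /= : nbhs (0 : A) [set y | d 0 y < d 0 (a - b)].
    by rewrite dE; exists (d 0 (a - b)).
  by rewrite ltxx.
(* Nonnegativity of [d] comes from the triangle inequality: [0 = d 0 0 <= 2 d 0 (a - b)]. *)
have := dT 0 (a - b) 0; rewrite (dC (a - b)) (d0 0 0).2// => h.
by rewrite -(pmulrn_lge0 _ (ltn0Sn 1)) mulr2n.
Qed.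

Lemma circ_continuous : continuous (fun p : A * A => circ p.1 p.2).
Proof.
move=> p; apply: (@continuous_comp (A * A)%type (A * A)%type A
  (fun q => (q.1 + q.2, q.1 ** q.2)) (fun q => q.1 - q.2)); last exact: sub_continuous.
by apply: cvg_pair; [exact: add_continuous|exact: frechet_mul_continuous].
Qed.

Lemma cvg_circ u v a b : u @ \oo --> a -> v @ \oo --> b ->
  (fun n => circ (u n) (v n)) @ \oo --> circ a b.
Proof.
by move=> ua vb; apply: continuous2_cvg => //; exact: (@circ_continuous (a, b)).
Qed.

Lemma nbhs_circr a U : nbhs (0 : A) U -> nbhs (0 : A) [set x | U (circ a x - a)].
Proof.
move=> U0; have := @circ_continuous (a, 0) [set z | U (z - a)].
rewrite /= circ0r => /(_ _)[].
  by apply/nbhs0_shift; apply: filterS U0 => x /=; rewrite addrK.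
move=> [W1 W2] /= [h1 h2] hW; apply: filterS h2 => x W2x.
by apply: (hW (a, x)); split => //=; exact: nbhs_singleton.
Qed.

(* If [x n] tends to 0 fast enough then the tails [y n] of the infinite circ product
   converge to 0. Once [y N] has a quasi-inverse z, the quasi-inverse of [y n] is
   [w n = z o x N o ... o x (n - 1)], which tends to [z o y N = 0]; hence so does the
   quasi-inverse [y n.+1 o w n] of [x n]. *)
Lemma qinv_continuous0 G U : nbhs (0 : A) G ->
  (forall x, G x -> exists c, qinv x c) -> nbhs (0 : A) U ->
  exists2 W, nbhs (0 : A) W & forall x c, W x -> qinv x c -> U c.
Proof.
move=> G0 Gq U0; apply: contrapT => noW.
have bad W : nbhs (0 : A) W -> exists x c, [/\ W x, qinv x c & ~ U c].
  move=> W0; apply: contrapT => h; apply: noW; exists W => // x c Wx xc.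
  by apply: contrapT => Uc; apply: h; exists x, c.
have [V [V0 VW VD]] := @frechet_base R A.
(* The new factor must move each of the finitely many partial products started at an index [n <= m]
   by an element of [V m.+2], so that all the infinite products converge at once. *)
have pick mP : exists xc : A * A, [/\ qinv xc.1 xc.2, ~ U xc.2 &
    forall n : nat, (n <= mP.1)%N -> V mP.1.+2 (circ (mP.2 n) xc.1 - mP.2 n)].
  case: mP => m P /=.
  have W0 : nbhs (0 : A)
      [set x | forall n : nat, (n <= m)%N -> V m.+2 (circ (P n) x - P n)].
    have : \forall x \near (0 : A), forall i : 'I_m.+1, V m.+2 (circ (P i) x - P i).
      by apply: filter_forall => i; apply: nbhs_circr.
    by apply: filterS => x h n nm; have := h (Ordinal (nm : (n < m.+1)%N)).
  by have [x [c [Wx xc Uc]]] := bad _ W0; exists (x, c).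
have [phi phiP] := choice pick.
(* [st m n] is the product of the factors chosen at the stages [n] to [m - 1], empty (that is, 0)
   when [n >= m]. The whole family is carried along because the next choice depends on it. *)
pose st := fix st m : nat -> A := if m is m'.+1 then
  (fun n => if (n <= m')%N then circ (st m' n) (phi (m', st m')).1 else 0) else fun _ => 0.
pose x m := (phi (m, st m)).1.
pose P n m := st m n.
have Pnn n : P n n = 0 by case: n => //= n; rewrite /P /= ltnn.
have PS n m : (n <= m)%N -> P n m.+1 = circ (P n m) (x m) by rewrite /P /= => ->.
have PV n m : (n <= m)%N -> V m.+2 (P n m.+1 - P n m).
  by move=> nm; rewrite PS//; have [_ _] := phiP (m, st m); exact.
have Py n : exists y, P n @ \oo --> y /\ V n y.
  have [y Py h] := @frechet_telescope_cvg R A V (P n) n V0 VW VD (PV n).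
  by exists y; split => //; have := h n (leqnn n); rewrite Pnn subr0.
have [y yP] := choice Py.
have Vle k i : V (i + k)%N `<=` V k.
  elim: i => [//|i IH] z Vz; apply: IH.
  by rewrite -[z]addr0; apply: VD => //; exact: nbhs_singleton.
have y0 : y @ \oo --> 0.
  apply/cvg_seqP => W /VW[k kW]; exists k => n kn; rewrite subr0; apply: kW.
  by apply: (Vle k (n - k)%N); rewrite subnK//; have [] := yP n.
have [N hN] : exists N, forall n, (N <= n)%N -> G (y n).
  by have /cvg_seqP/(_ _ G0)[N hN] := y0; exists N => n /hN; rewrite subr0.
have Psplit n m k : (n <= m)%N -> P n (m + k)%N = circ (P n m) (P m (m + k)%N).
  move=> nm; elim: k => [|k IH]; first by rewrite addn0 Pnn circ0r.
  by rewrite addnS !PS ?leq_addr ?(leq_trans nm) ?leq_addr// IH circA.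
have ysplit n m : (n <= m)%N -> y n = circ (P n m) (y m).
  move=> nm; have [hn _] := yP n; have [hm _] := yP m.
  have h1 : (fun k => circ (P n m) (P m k)) @ \oo --> circ (P n m) (y m).
    by apply: cvg_circ => //; exact: cvg_cst.
  apply: cvg_seq_unique hn _; apply: cvg_trans h1.
  apply: near_eq_cvg; exists m => // k /= mk.
  by have := Psplit n m (k - m)%N nm; rewrite subnKC// => ->.
have [z [yz zy]] := Gq _ (hN N (leqnn _)).
pose w n := circ z (P N n).
have wy n : (N <= n)%N -> circ (w n) (y n) = 0.
  by move=> Nn; rewrite /w -circA -ysplit.
(* By construction [w n] is a left inverse only; [y n] lies in [G], so it has a two-sided one, which
   must be [w n]. *)
have yw n : (N <= n)%N -> circ (y n) (w n) = 0.
  move=> Nn; have [zn [yz' zy']] := Gq _ (hN n Nn).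
  by rewrite (qinv_uniq (wy n Nn) yz').
have w0 : w @ \oo --> 0.
  by rewrite -zy; apply: cvg_circ; [exact: cvg_cst|have [] := yP N].
have c0 : (fun n => circ (y n.+1) (w n)) @ \oo --> 0.
  rewrite -(circ0l 0); apply: cvg_circ => //.
  apply/cvg_seqP => W W0; have /cvg_seqP/(_ _ W0)[k hk] := y0.
  by exists k => n kn; apply: hk; exact: leqW.
have /cvg_seqP/(_ _ U0)[M hM] := c0.
pose n := maxn M N.
have [xc Uc _] := phiP (n, st n).
apply: Uc; have := hM n (leq_maxl _ _); rewrite subr0.
congr U; apply/esym; apply: qinv_uniq; first by have [_ +] := xc; exact.
have nN : (N <= n)%N by exact: leq_maxr.
have -> : (phi (n, st n)).1 = P n n.+1 by rewrite PS// Pnn circ0l.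
by rewrite circA -ysplit// yw.
Qed.

End qinv_continuity.


(** * Spectral projections as limits of dyadic means *)
Section dyadic_mean.
Context {R : realType}.

(** The left Riemann sum of [Q] over [[x, x + h]] with [2^m] nodes, divided by [h]. Recursion on the
    two halves lets convexity arguments run by induction. *)
Fixpoint dyad (M : lmodType R[i]) (Q : R -> M) (m : nat) (x h : R) : M :=
  if m is m'.+1 then 2^-1 *: (dyad Q m' x (h / 2) + dyad Q m' (x + h / 2) (h / 2))
  else Q x.

Section lmod.
Context {M : lmodType R[i]}.
Implicit Types (Q : R -> M) (U : set M).

Lemma half_add_half : 2^-1 + 2^-1 = 1 :> R[i].
Proof. by rewrite [RHS]splitr mul1r. Qed.

Lemma scale_half (v : M) : 2^-1 *: (v + v) = v.
Proof. by rewrite scalerDr -scalerDl half_add_half scale1r. Qed.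

(** The nodes are split by parity instead of by halves: on the circle the odd nodes are the even
    ones rotated, which is what an induction on roots of unity requires. *)
Lemma dyadS_even_odd Q m x h : dyad Q m.+1 x h =
  2^-1 *: (dyad Q m x h + dyad Q m (x + h / 2 ^+ m.+1) h).
Proof.
elim: m x h => [|m IH] x h; first by rewrite /= expr1.
rewrite -[LHS]/(2^-1 *: (dyad Q m.+1 x (h / 2) + dyad Q m.+1 (x + h / 2) (h / 2))).
rewrite !(IH _ (h / 2)) /= -!scalerDr; congr (_ *: (_ *: _)).
have -> : h / 2 / 2 ^+ m.+1 = h / 2 ^+ m.+2 by rewrite [2 ^+ m.+2]exprS invfM mulrA.
by rewrite addrACA; congr (_ + (_ + dyad _ _ _ _)); rewrite addrAC.
Qed.

Lemma dyad_linear (N : lmodType R[i]) (f : M -> N) Q m x h : linear f ->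
  f (dyad Q m x h) = dyad (f \o Q) m x h.
Proof.
move=> linf; have fh u v : f (2^-1 *: (u + v)) = 2^-1 *: (f u + f v).
  have f0 : f 0 = 0 by have := linf (-1) 0 0; rewrite !scaleN1r oppr0 addr0 addNr.
  have := linf 2^-1 (u + v) 0; rewrite f0 !addr0 => ->.
  by have := linf 1 u v; rewrite !scale1r => ->.
by elim: m x h => [//|m IH] x h /=; rewrite fh !IH.
Qed.

Lemma dyadB Q Q' m x h :
  dyad (fun y => Q y - Q' y) m x h = dyad Q m x h - dyad Q' m x h.
Proof.
elim: m x h => [//|m IH] x h /=; rewrite !IH -scalerBr opprD.
by rewrite addrACA.
Qed.

Lemma dyad_cst (v : M) m x h : dyad (fun=> v) m x h = v.
Proof. by elim: m x h => [//|m IH] x h /=; rewrite !IH scale_half. Qed.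

Definition midconvex U := forall u v, U u -> U v -> U (2^-1 *: (u + v)).

Lemma dyad_midconvex U Q m x h : midconvex U -> 0 <= h ->
  (forall y, x <= y <= x + h -> U (Q y)) -> U (dyad Q m x h).
Proof.
move=> Uc; elim: m x h => [|m IH] x h h0 UQ /=.
  by apply: UQ; rewrite lexx lerDl.
have h20 : 0 <= h / 2 by rewrite divr_ge0.
have h2h : h / 2 <= h by rewrite ler_pdivrMr// ler_peMr// ler1n.
apply: Uc; apply: IH => // y /andP[xy yx]; apply: UQ; apply/andP; split => //.
- by apply: le_trans yx _; rewrite lerD2l.
- by apply: le_trans xy; rewrite lerDl.
- by rewrite -addrA -splitr in yx.
Qed.

(** After [k] halvings each cell has length at most [d]. There the finer mean minus the value at the
    left end is a mean of differences in [U], and midpoint convexity assembles the cells. *)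
Lemma dyad_refine U Q k m x h (a b d : R) : midconvex U -> 0 <= h -> h <= 2 ^+ k * d ->
  (forall y y', a <= y <= b -> a <= y' <= b -> `|y - y'| <= d -> U (Q y - Q y')) ->
  a <= x -> x + h <= b -> U (dyad Q (k + m) x h - dyad Q k x h).
Proof.
move=> Uc; elim: k x h => [|k IH] x h h0 hd UQ ax xb.
  rewrite add0n /= -[X in _ - X](dyad_cst _ m x h) -dyadB.
  apply: dyad_midconvex => // y /andP[xy yx]; apply: UQ.
  - by rewrite (le_trans ax xy) (le_trans yx xb).
  - by rewrite ax /= (le_trans _ xb)// lerDl.
  rewrite ger0_norm ?subr_ge0// lerBlDr addrC (le_trans yx)// lerD2l.
  by move: hd; rewrite mul1r.
have h20 : 0 <= h / 2 by rewrite divr_ge0.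
have hd2 : h / 2 <= 2 ^+ k * d by rewrite ler_pdivrMr// mulrC mulrA -exprS.
have xb' : x + h / 2 + h / 2 <= b by rewrite -addrA -splitr.
rewrite addSn /= -scalerBr opprD addrACA.
apply: Uc; apply: IH => //.
- by apply: le_trans xb'; rewrite lerDl.
- by apply: (le_trans ax); rewrite lerDl.
Qed.

End lmod.

Definition expi (x : R) : R[i] := cos x +i* sin x.

Lemma expiD x y : expi (x + y) = expi x * expi y.
Proof.
by apply/eqP; rewrite eq_complex /= cosD sinD eqxx /= [X in X == _]addrC.
Qed.

Lemma expiX x n : expi x ^+ n = expi (x *+ n).
Proof.
elim: n => [|n IH]; last by rewrite exprS IH mulrS expiD.
by rewrite expr0 mulr0n /expi cos0 sin0.
Qed.

Lemma expi_pi : expi pi = -1.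
Proof. by apply/eqP; rewrite eq_complex /= cospi sinpi oppr0 !eqxx. Qed.

Lemma normr_expi x : `|expi x| = 1.
Proof. by rewrite normc_def /= cos2Dsin2 sqrtr1. Qed.

Definition nusqr (B : nuAlgType R[i]) (b : B) := b ** b.

(* [1 / (1 - z ^ n)] is the mean of [1 / (1 - w z)] over the n-th roots of unity w. *)
Lemma dyad_qinv (B : nuAlgType R[i]) (b : B) (rho : R[i]) (Q : R -> B) m x :
  (forall y, qinv ((rho * expi y) *: b) (Q y)) ->
  qinv ((rho * expi x) ^+ (2 ^ m) *: iter m (@nusqr B) b) (dyad Q m x (pi *+ 2)).
Proof.
move=> bQ; elim: m x => [|m IH] x; first by rewrite expn0 expr1.
rewrite dyadS_even_odd.
set w := (rho * expi x) ^+ (2 ^ m) *: iter m (@nusqr B) b.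
have -> : (rho * expi x) ^+ (2 ^ m.+1) *: iter m.+1 (@nusqr B) b = w ** w.
  by rewrite /w numulZl numulZr scalerA -exprD addnn -mul2n -expnS.
apply: qinv_sqr => //; [exact: half_add_half|exact: IH|].
(* Shifting the angle by [2 pi / 2^(m+1)] multiplies the [2^m]-th power by [expi pi = -1]. *)
have -> : - w = (rho * expi (x + pi *+ 2 / 2 ^+ m.+1)) ^+ (2 ^ m) *: iter m (@nusqr B) b.
  rewrite /w -scaleNr; congr (_ *: _); rewrite expiD mulrA [RHS]exprMn expiX.
  suff -> : pi *+ 2 / 2 ^+ m.+1 *+ 2 ^ m = pi :> R by rewrite expi_pi mulrN1.
  by rewrite -[pi *+ 2]mulr_natr -[X in X = _]mulr_natr exprS invfM mulrA mulfK// natrX mulfVK.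
exact: IH.
Qed.

End dyadic_mean.


(** * Continuity of resolvents and convergence of circle means *)

Section complex_topology.
Context {R : realType}.

Lemma posC_Re (e : R[i]) : 0 < e -> exists2 r : R, 0 < r & e = r%:C.
Proof.
case: e => a b; rewrite ltcE /= => /andP[/eqP -> a0].
by exists a.
Qed.

Lemma normC_real (x : R) : `|x%:C| = `|x|%:C.
Proof. by rewrite normc_def /= expr0n addr0 sqrtr_sqr. Qed.

Lemma real_complex_continuous : continuous (fun x : R => x%:C : R[i]^o).
Proof.
move=> x U /nbhs_ballP[_ /= /posC_Re[e e0 ->] eU].
apply/nbhs_ballP; exists e => //= y xy; apply: eU.
by rewrite -ball_normE /= -raddfB normC_real ltcR; rewrite -ball_normE in xy.
Qed.

Lemma complex_continuous (T : topologicalType) (f g : T -> R) :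
  continuous f -> continuous g -> continuous (fun t => f t +i* g t : R[i]^o).
Proof.
move=> cf cg t.
have -> : (fun t => f t +i* g t) = (fun t => (f t)%:C + 'i%C *: ((g t)%:C : R[i]^o)) :> (T -> R[i]^o).
  by apply/funext => s; rewrite [LHS]complexE.
apply: cvgD.
  by apply: (@cvg_comp _ _ _ f (fun x : R => x%:C : R[i]^o)); [exact: cf|exact: real_complex_continuous].
apply: cvgZr.
by apply: (@cvg_comp _ _ _ g (fun x : R => x%:C : R[i]^o)); [exact: cg|exact: real_complex_continuous].
Qed.

Lemma expi_continuous : continuous (@expi R : R -> R[i]^o).
Proof. by apply: complex_continuous; [exact: continuous_cos|exact: continuous_sin]. Qed.

End complex_topology.

Section frechet_integral.
Context {R : realType} {A : frechetAlgType R}.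
Implicit Types (U V W : set A).

Lemma nbhs0_midconvex U : nbhs (0 : A) U ->
  exists W, [/\ nbhs (0 : A) W, W `<=` U & midconvex W].
Proof.
have [B Bconv [Bopen Bb]] := @locally_convex R[i] A.
move=> /Bb[W [BW W0] WU]; exists W; split => //.
  by apply: open_nbhs_nbhs; split => //; exact: Bopen.
move=> u v Wu Wv.
have h0 : 0 <= (2^-1 : R[i]) by rewrite invr_ge0 ler0n.
have h1 : (2^-1 : R[i]) <= 1 by rewrite invf_le1 ?ltr0n ?ler1n.
have /set_mem := Bconv W (mem_set BW) u v (Itv01 h0 h1) (mem_set Wu) (mem_set Wv).
rewrite /conv /= /unstable.onem -[X in X - 2^-1]half_add_half addrK.
by rewrite -scalerDr.
Qed.

Lemma uniform_continuous_itv (Q : R -> A) (r s : R) U : continuous Q -> nbhs (0 : A) U ->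
  exists2 d : R, 0 < d & forall y y', r <= y <= s -> `|y - y'| <= d -> U (Q y - Q y').
Proof.
move=> cQ /nbhs0_half[W W0 WU].
have W'0 : nbhs (0 : A) (-%R @^-1` W).
  by apply: (@opp_continuous A 0); rewrite oppr0.
have /compact_near_coveringP/(_ R (0%R^'+) (fun d y => forall y', `|y - y'| <= d -> U (Q y - Q y'))) :
  compact `[r, s]%classic by exact: segment_compact.
have Qloc (y : R) : \forall y1 \near y & d \near 0^'+,
    forall y', `|y1 - y'| <= d -> U (Q y1 - Q y').
  have /cQ : nbhs (Q y) [set z | W (z - Q y) /\ W (Q y - z)].
    apply/nbhs0_shift; apply: filterS (filterI W0 W'0) => z /=.
    by rewrite addrK opprD addrCA subrr addr0.
  move=> /nbhs_ballP[e /= e0 he].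
  have e20 : 0 < e / 2 by rewrite divr_gt0.
  exists (ball y (e / 2), [set d | d < e / 2]) => /=.
    by split; [exact: nbhsx_ballx|exact: nbhs_right_lt].
  move=> [y1 d] /= [yy1 de] y2 y12.
  rewrite -(subrK (Q y) (Q y1)) -addrA; apply: WU.
    by have [] := he y1 (le_ball (_ : e / 2 <= e) yy1); rewrite // ler_pdivrMr// ler_peMr ?ler1n// ltW.
  have [] // := he y2 _.
  apply: (@ball_split _ _ y1) => //.
  by rewrite -ball_normE /=; apply: le_lt_trans de.
move=> /(_ _ (fun y _ => Qloc y)) /= near_d.
have [d [d0 hd]] : exists d : R, 0 < d /\
   forall y, r <= y <= s -> forall y', `|y - y'| <= d -> U (Q y - Q y').
  near (0 : R)^'+ => d; exists d; split; first by near: d; exact: nbhs_right_gt.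
  move=> y rys; have : `[r, s]%classic `<=` (fun y => forall y', `|y - y'| <= d -> U (Q y - Q y')).
    by near: d.
  by apply; rewrite /= in_itv.
by exists d => // y y' rys; exact: hd.
Unshelve. all: by end_near. Qed.

Lemma dyad_cvg (Q : R -> A) (h : R) : 0 <= h -> continuous Q ->
  exists P : A, (fun m => dyad Q m 0 h) @ \oo --> P.
Proof.
move=> h0 cQ; apply: frechet_cauchy_cvg => U /nbhs0_half[W W0 WU].
have W'0 : nbhs (0 : A) (-%R @^-1` W).
  by apply: (@opp_continuous A 0); rewrite oppr0.
have [Z [Z0 ZW Zc]] := nbhs0_midconvex (filterI W0 W'0).
have [d d0 hd] := uniform_continuous_itv 0 h cQ Z0.
have [N hN] : exists N : nat, h <= 2 ^+ N * d.
  exists (Num.truncn (h / d)).+1; rewrite -ler_pdivrMr//.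
  apply: le_trans (ltW (truncnS_gt _)) _.
  by rewrite -natrX ler_nat ltnW// ltn_expl.
have Nm m : (N <= m)%N -> Z (dyad Q m 0 h - dyad Q N 0 h).
  move=> /subnKC <-.
  apply: (@dyad_refine _ _ _ _ _ _ _ _ 0 h d) => //; last by rewrite add0r.
  by move=> y y' yh _; exact: hd.
exists N => m n /Nm /ZW[Wm _] /Nm /ZW[_ Wn].
by have := WU _ _ Wm Wn; rewrite opprB addrA subrK.
Qed.

Lemma scale_fun_continuous (T : topologicalType) (f : T -> R[i]^o) (b : A) :
  continuous f -> continuous (fun t => f t *: b).
Proof.
move=> cf t.
apply: (@continuous2_cvg _ _ _ _ _ _ f (fun=> b) (fun (k : R[i]^o) (v : A) => k *: v) (f t) b).
- exact: (@scale_continuous _ _ (f t, b)).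
- exact: cf.
- exact: cvg_cst.
Qed.

(** Continuity at 0 is transported to [t]: the quasi-inverse of [circ (Q t) (x s)], which tends to 0
    as [s] tends to [t], is [circ (Q s) (x t)], and composing the latter with [Q t] gives back
    [Q s]. *)
Lemma resolvent_continuous G (rho : R[i]) (b : A) (Q : R -> A) : nbhs (0 : A) G ->
  (forall x, G x -> exists c, qinv x c) ->
  (forall y, qinv ((rho * expi y) *: b) (Q y)) -> continuous Q.
Proof.
move=> G0 Gq bQ t.
pose x s := (rho * expi s) *: b.
have cx : continuous x.
  have ce : continuous (fun s : R => rho *: (expi s : R[i]^o)).
    by move=> s; apply: cvgZr; exact: expi_continuous.
  by move=> s; exact: (@scale_fun_continuous _ _ b ce s).
have cd : (fun s => circ (Q t) (x s)) @ t --> (0 : A).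
  have <- : circ (Q t) (x t) = 0 by have [] := bQ t.
  apply: (@continuous2_cvg _ _ _ _ _ _ (fun=> Q t) x circ) => //.
  - exact: (@circ_continuous _ _ (Q t, x t)).
  - exact: cvg_cst.
  - exact: cx.
have ce : (fun s => circ (Q s) (x t)) @ t --> (0 : A).
  move=> U U0; have [W W0 hW] := qinv_continuous0 G0 Gq U0.
  have h : nbhs t [set s | W (circ (Q t) (x s))] by exact: cd.
  apply: (@filterS _ (nbhs t) _ [set s | W (circ (Q t) (x s))]) => // s Ws.
  apply: (hW (circ (Q t) (x s))) => //.
  by apply: qinv_circ (bQ s); apply: qinvC; exact: bQ.
have QE : (fun s => circ (circ (Q s) (x t)) (Q t)) = Q.
  by apply/funext => s; rewrite -circA; have [-> _] := bQ t; rewrite circ0r.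
have : (fun s => circ (circ (Q s) (x t)) (Q t)) @ t --> circ 0 (Q t).
  apply: (@continuous2_cvg _ _ _ _ _ _ (fun s => circ (Q s) (x t)) (fun=> Q t) circ) => //.
  - exact: (@circ_continuous _ _ (0, Q t)).
  - exact: cvg_cst.
by rewrite QE circ0l.
Qed.

End frechet_integral.


(** * Compact operators *)
Section neumann.
Context {R : realType} {H : completeNormedModType R[i]}.
Implicit Types (S T k : compop H) (x y : H).

Lemma compopB T x y : T (x - y) = T x - T y.
Proof. by have := compopD T (-1) y x; rewrite !scaleN1r addrC [X in _ = X]addrC. Qed.

Lemma compopN T x : T (- x) = - T x.
Proof. by rewrite -scaleN1r compopZ scaleN1r. Qed.

Lemma compop_add T x y : T (x + y) = T x + T y.
Proof. by have := compopD T 1 x y; rewrite !scale1r. Qed.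

Lemma compop_normP T x : `|T x| <= `|T| * `|x|.
Proof. exact: opnormP. Qed.

Lemma compop_norm_le T (M : R[i]) : 0 <= M -> (forall x, `|T x| <= M * `|x|) -> `|T| <= M.
Proof.
move=> M0 h; have ME : M = (complex.Re M)%:C by rewrite RRe_real// ger0_real.
rewrite ME compop_normE lecR; apply: opnorm_le => x x1; rewrite -ME.
by apply: le_trans (h x) _; rewrite ler_piMr.
Qed.

Lemma compop_norm_mul S T : `|S ** T| <= `|S| * `|T|.
Proof.
apply: compop_norm_le => [|x]; first by rewrite mulr_ge0.
rewrite mul_compopE (le_trans (compop_normP _ _))// -mulrA ler_wpM2l//.
exact: compop_normP.
Qed.

Lemma compop_cvg T (u : nat -> H) x : u @ \oo --> x -> (fun n => T (u n)) @ \oo --> T x.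
Proof.
move=> /cvgrPdist_lt ux; apply/cvgrPdist_lt => e e0.
have M0 : 0 < `|T| + 1 by rewrite ltr_wpDl.
have /ux : 0 < e / (`|T| + 1) by rewrite divr_gt0.
apply: filterS => n; rewrite ltr_pdivlMr// => h; rewrite -compopB.
apply: le_lt_trans (compop_normP _ _) _; apply: le_lt_trans h.
by rewrite mulrC ler_wpM2l// lerDl.
Qed.

Lemma exprC_small (q : R) (C e : R[i]) : 0 <= q -> q < 1 -> 0 <= C -> 0 < e ->
  exists n, q%:C ^+ n * C < e.
Proof.
move=> q0 q1 C0 /posC_Re[r r0 ->].
have -> : C = (complex.Re C)%:C by rewrite RRe_real// ger0_real.
have {}C0 : 0 <= complex.Re C by rewrite -lecR RRe_real// ger0_real.
have := @cvg_geometric R (complex.Re C) q; rewrite ger0_norm// => /(_ q1).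
move=> /cvgrPdist_lt /(_ _ r0)[N _ /(_ N (leqnn N))] /=.
rewrite sub0r normrN ger0_norm ?mulr_ge0 ?exprn_ge0// => h.
by exists N; rewrite -rmorphXn -rmorphM ltcR /= mulrC.
Qed.

Lemma compop_solve k y : `|k| < 1 -> exists x, x = y + k x.
Proof.
rewrite compop_normE; set q := opnorm k => q1.
have {}q1 : q < 1 by rewrite -ltcR.
have q0 : 0 <= q by exact: opnorm_ge0.
have qC0 : 0 <= q%:C by rewrite lecR.
have q1C : 0 < 1 - q%:C by rewrite subr_gt0 ltcR.
pose u n := iter n (fun x => y + k x) 0.
(* [C] solves [|y| + q C = C], so the iterates never leave the ball of radius [C]. *)
pose C := `|y| / (1 - q%:C).
have C0 : 0 <= C by rewrite divr_ge0// ltW.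
have uC n : `|u n| <= C.
  elim: n => [|n IH] /=; first by rewrite normr0.
  apply: le_trans (ler_normD _ _) _.
  apply: le_trans (lerD (lexx _) (opnormP _ _)) _; rewrite -/q.
  apply: le_trans (lerD (lexx _) (ler_wpM2l qC0 IH)) _.
  have -> : `|y| = (1 - q%:C) * C by rewrite mulrC divfK// gt_eqF.
  by rewrite -mulrDl subrK mul1r.
have uD n m : `|u (n + m)%N - u n| <= q%:C ^+ n * C.
  elim: n => [|n IH]; first by rewrite add0n subr0 mul1r.
  rewrite addSn /= opprD addrACA subrr add0r -compopB.
  by apply: le_trans (opnormP _ _) _; rewrite exprS -mulrA ler_wpM2l.
have /cauchy_cvgP/cvg_ex[x ux] : cauchy (u @ \oo).
  apply: cauchy_exP => e e0; have [N hN] := exprC_small q0 q1 C0 e0.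
  exists (u N); exists N => // n /= Nn; rewrite -ball_normE /= distrC.
  by apply: le_lt_trans hN; rewrite -(subnKC Nn).
exists x; apply: (@cvg_unique _ (@norm_hausdorff _ H) ((fun n => u n.+1) @ \oo)).
  by move=> U /ux[N _ hN]; exists N => // n Nn; exact: (hN n.+1 (leqW Nn)).
by apply: cvgD; [exact: cvg_cst|exact: compop_cvg].
Qed.

Lemma compop_solve_bound k x y : `|k| < 1 -> x = y + k x -> `|x| <= `|y| / (1 - `|k|).
Proof.
move=> k1 xE; rewrite ler_pdivlMr ?subr_gt0// mulrBr mulr1 lerBlDr.
rewrite {1}xE (le_trans (ler_normD _ _))// lerD2l mulrC.
exact: compop_normP.
Qed.

(** Completeness of [H] gives [S = (1 - k)^-1] pointwise. Since [1 - S = - k S] and [S] is bounded,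
    the quasi-inverse [- k S] inherits compactness from [k]. *)
Lemma neumann k : `|k| < 1 -> exists2 c, qinv k c & `|c| <= `|k| / (1 - `|k|).
Proof.
move=> k1; have k1' : 0 < 1 - `|k| by rewrite subr_gt0.
have [S SE] := choice (fun y => compop_solve y k1).
have Suniq x y : x = y + k x -> x = S y.
  move=> xE; apply/eqP; rewrite -subr_eq0 -normr_le0.
  have -> : 0 = `|0 : H| / (1 - `|k|) by rewrite normr0 mul0r.
  apply: compop_solve_bound => //.
  by rewrite add0r compopB {1}xE {1}SE opprD addrACA subrr add0r.
have Slin : linear S.
  move=> a u v; apply/esym/Suniq; rewrite compopD {1}SE {1}(SE v).
  by rewrite scalerDr addrACA.
have Sb y : `|S y| <= `|y| / (1 - `|k|) by exact: compop_solve_bound.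
pose M := (1 - `|k|)^-1.
have M0 : 0 < M by rewrite invr_gt0.
have cP : (fun x => - k (S x)) \in @compact_operator_pred R H.
  apply/compact_operatorP; split.
    by move=> a u v; rewrite Slin compopD opprD scalerN.
  have [_ pre] := compopP (M *: k).
  apply: precompact_subset pre => _ [x /= x1 <-].
  (* The bound on [S] puts this vector in the unit ball, so the image of the ball under [- k S] lies
     in its image under the compact operator [M *: k]. *)
  exists (- M^-1 *: S x).
    have h : `|S x| * (1 - `|k|) <= 1.
      by rewrite -ler_pdivlMr// (le_trans (Sb x))// ler_wpM2r// ltW.
    have -> : M^-1 = 1 - `|k| by rewrite /M invrK.
    by rewrite /= normrZ normrN (ger0_norm (ltW k1')) mulrC.
  by rewrite -[LHS]/(M *: k (- M^-1 *: S x)) compopZ scalerA mulrN mulfV ?scaleN1r// gt_eqF.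
exists (Compop cP); last first.
  apply: compop_norm_le => [|x /=]; first by rewrite divr_ge0// ltW.
  rewrite normrN (le_trans (compop_normP _ _))// -mulrA ler_wpM2l// mulrC.
  exact: Sb.
split; apply/compop_eqP => x.
  rewrite /circ -[LHS]/(k x + - k (S x) - k (- k (S x))) compopN opprK.
  by rewrite -addrA addrC -addrA -[X in - X + _]/(k (S x)) {1}(SE x) compop_add opprD addrA addrNK addNr.
have SkE : S (k x) = S x - x.
  apply/esym/Suniq; rewrite compopB {1}SE [x + _]addrC addrK [k x + _]addrC subrK.
  by [].
rewrite /circ -[LHS]/(- k (S x) + k x - - k (S (k x))) SkE opprK compopB.
by rewrite addrACA addNr add0r subrr.
Qed.

(* [1 - x' = (1 - x)(1 - y)] with [y = (1 - c)(x' - x)] small. *)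
Lemma qinv_perturb (x x' c : compop H) (M d : R[i]) : qinv x c -> 1 + `|c| <= M ->
  `|x' - x| <= d -> M * d < 1 ->
  exists2 c', qinv x' c' & `|c' - c| <= M ^+ 2 * d / (1 - M * d).
Proof.
move=> xc cM xd d1; have M0 : 0 <= M by apply: le_trans cM; rewrite addr_ge0.
set D := M * d in d1 *.
pose y := circ c x'.
have yE : y = (x' - x) - c ** (x' - x).
  rewrite /y /circ numulBr (qinv_mulr xc) opprB addrA; congr (_ - _).
  by rewrite addrA subrK addrC.
have yD : `|y| <= D.
  apply: le_trans (_ : (1 + `|c|) * `|x' - x| <= _); last exact: ler_pM.
  rewrite yE (le_trans (ler_normB _ _))// mulrDl mul1r lerD2l.
  exact: compop_norm_mul.
have [z yz zb] := neumann (le_lt_trans yD d1).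
have zD : `|z| <= D / (1 - D).
  apply: le_trans zb _; rewrite ler_pM ?invr_ge0 ?subr_ge0//.
    exact: le_trans (ltW d1).
  by rewrite lef_pV2 ?posrE ?subr_gt0 ?(le_lt_trans yD)// lerB.
exists (circ z c).
  have -> : x' = circ x y by rewrite /y circA; have [-> _] := xc; rewrite circ0l.
  exact: qinv_circ.
have -> : circ z c - c = z - z ** c by rewrite /circ addrAC addrK.
apply: le_trans (ler_normB _ _) _.
apply: le_trans (lerD (lexx _) (compop_norm_mul _ _)) _.
have -> : `|z| + `|z| * `|c| = (1 + `|c|) * `|z| by rewrite mulrDl mul1r [`|c| * _]mulrC.
by rewrite expr2 -!mulrA; apply: ler_pM => //; rewrite mulrA.
Qed.

End neumann.


(** * Lines in normed spaces and rank one operators on a Hilbert space *)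

Lemma normc_ge_Im (R : rcfType) (z : R[i]) : `|complex.Im z|%:C <= `|z|.
Proof. by rewrite normc_def lecR -sqrtr_sqr ler_wsqrtr// lerDr sqr_ge0. Qed.

Section line.
Context {R : realType} {V : normedModType R[i]}.

Lemma compact_disc (M : R) (w : V) :
  exists C : set V, [/\ compact C, forall z, C z -> exists k : R[i], z = k *: w &
    forall z : R[i], `|z| <= M%:C -> C (z *: w)].
Proof.
pose f (p : R * R) : V := ((p.1 +i* p.2 : R[i]^o) : R[i]) *: w.
have cf : continuous f.
  move=> p; apply: cvgZl.
  have := @complex_continuous R (R * R)%type fst snd.
  by apply; [move=> q; exact: cvg_fst|move=> q; exact: cvg_snd].
exists (f @` (`[- M, M]%classic `*` `[- M, M]%classic)); split.
- apply: continuous_compact; first exact: continuous_subspaceT.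
  by apply: compact_setX; exact: segment_compact.
- by move=> _ [p _ <-]; exists (p.1 +i* p.2).
move=> z zM; exists (complex.Re z, complex.Im z).
  split; rewrite /= in_itv /= -ler_norml -lecR.
    by rewrite (le_trans (normc_ge_Re z)).
  by rewrite (le_trans (normc_ge_Im z)).
by rewrite /f /=; congr (_ *: _); case: z {zM}.
Qed.

(** Multiples of [w] within distance 1 of [x] have coefficients bounded by [(|x| + 1) / |w|], so a
    point of the closure lies in the closure of a compact piece of the line. *)
Lemma line_closed (w : V) : closed [set k *: w | k in [set: R[i]]].
Proof.
have [->|w0] := eqVneq w 0.
  have -> : [set k *: (0 : V) | k in [set: R[i]]] = [set 0].
    apply/seteqP; split => [_ [k _ <-]|_ ->] /=; first by rewrite scaler0.
    by exists 0; rewrite ?scaler0.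
  by apply: compact_closed; [exact: norm_hausdorff|exact: compact_set1].
have nw : 0 < `|w| by rewrite normr_gt0.
move=> x clx.
pose M := complex.Re ((`|x| + 1) / `|w|).
have ME : M%:C = (`|x| + 1) / `|w|.
  by rewrite RRe_real// ger0_real// divr_ge0// addr_ge0.
have [C [cC Cw CP]] := compact_disc M w.
have : closure C x.
  move=> U nU; have nb : nbhs x (ball x 1) by exact: nbhsx_ballx.
  have [_ [[k _ <-] [Uk]]] := clx _ (filterI nU nb).
  rewrite -ball_normE /= => xk; exists (k *: w); split => //; apply: CP.
  rewrite ME ler_pdivlMr// -normrZ -[k *: w](subrK x) addrC.
  by apply: le_trans (ler_normD _ _) _; rewrite lerD2l distrC ltW.
rewrite -(proj1 (closure_id _)); last first.
  by apply: compact_closed => //; exact: norm_hausdorff.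
by move=> /Cw[k ->]; exists k.
Qed.

End line.

Section hilbert.
Context {R : realType} {H : completeNormedModType R[i]}
  (dot : {dot H for @Num.conj R[i]}) (H_hilbert : hilbert_norm dot).
Implicit Types (u v w x y : H) (T k : compop H).

Lemma dotZl a x v : dot (a *: x) v = a * dot x v.
Proof. by rewrite linearZl_LR. Qed.

Lemma dotDl x y v : dot (x + y) v = dot x v + dot y v.
Proof. by rewrite linearDl. Qed.

Lemma dotBl x y v : dot (x - y) v = dot x v - dot y v.
Proof. by rewrite linearBl. Qed.

Lemma dot_eq0 v : dot v v = 0 -> v = 0.
Proof. by rewrite -H_hilbert => /eqP; rewrite expf_eq0 /= normr_eq0 => /eqP. Qed.

Lemma pythagoras x y : dot x y = 0 -> `|x + y| ^+ 2 = `|x| ^+ 2 + `|y| ^+ 2.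
Proof. by move=> xy; rewrite !H_hilbert hnormDd. Qed.

Lemma proj_norm_le x v : `|v| = 1 -> `|dot x v| <= `|x| /\ `|x - dot x v *: v| <= `|x|.
Proof.
move=> v1; have vv : dot v v = 1 by rewrite -H_hilbert v1 expr1n.
have : `|x| ^+ 2 = `|x - dot x v *: v| ^+ 2 + `|dot x v| ^+ 2.
  have orth : dot (x - dot x v *: v) (dot x v *: v) = 0.
    by rewrite linearZr_LR /= dotBl dotZl vv mulr1 subrr mulr0.
  by have := pythagoras orth; rewrite subrK => ->; rewrite normrZ v1 mulr1.
move=> xE; split; rewrite -(@ler_pXn2r _ 2) ?nnegrE// xE.
  by rewrite lerDr exprn_ge0.
by rewrite lerDl exprn_ge0.
Qed.

Lemma cauchy_schwarz x v : `|dot x v| <= `|x| * `|v|.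
Proof.
have [->|v0] := eqVneq v 0; first by rewrite linear0r !normr0 mulr0.
have nv : 0 < `|v| by rewrite normr_gt0.
have [+ _] := @proj_norm_le x (`|v|^-1 *: v) (normfZV v0).
rewrite linearZr_LR /= normrM norm_conjC normfV normr_id.
by rewrite mulrC ler_pdivrMr.
Qed.

Lemma rank1_compact w v : (fun x => dot x v *: w) \in @compact_operator_pred R H.
Proof.
apply/compact_operatorP; split.
  by move=> a x y; rewrite dotDl dotZl scalerDl scalerA.
have [C [cC _ CP]] := compact_disc (complex.Re `|v|) w.
apply: (@Defs.compact_precompact _ _ _ C) => // _ [x /= x1 <-]; apply: CP.
by rewrite -Defs.normcE (le_trans (cauchy_schwarz _ _))// ler_piMl.
Qed.

Definition rank1 w v : compop H := Compop (rank1_compact w v).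

Lemma rank1E w v x : rank1 w v x = dot x v *: w. Proof. by []. Qed.

Lemma norm_rank1 w v : `|rank1 w v| <= `|w| * `|v|.
Proof.
apply: compop_norm_le => [|x]; first by rewrite mulr_ge0.
by rewrite rank1E normrZ [_ * `|x|]mulrC [`|w| * _]mulrC mulrA ler_wpM2r// cauchy_schwarz.
Qed.

Lemma mul_rank1 T w v : T ** rank1 w v = rank1 (T w) v.
Proof. by apply/compop_eqP => x; rewrite mul_compopE !rank1E compopZ. Qed.

End hilbert.


(** * A rank one element of the subalgebra *)
Section nualg_morphism.
Context {K : pzRingType} {A B : nuAlgType K} (j : A -> B) (jm : nualg_morphism j).

Lemma nualgD a b : j (a + b) = j a + j b.
Proof. by have := jm.1 1 a b; rewrite !scale1r. Qed.

Lemma nualg0 : j 0 = 0.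
Proof. by apply/(addrI (j 0)); rewrite -nualgD !addr0. Qed.

Lemma nualgZ k a : j (k *: a) = k *: j a.
Proof. by have := jm.1 k a 0; rewrite nualg0 !addr0. Qed.

Lemma nualgB a b : j (a - b) = j a - j b.
Proof. by rewrite nualgD -scaleN1r nualgZ scaleN1r. Qed.

Lemma nualg_circ a b : j (circ a b) = circ (j a) (j b).
Proof. by rewrite /circ nualgB nualgD jm.2. Qed.

Lemma nualg_qinv a c : qinv a c -> qinv (j a) (j c).
Proof. by move=> [h1 h2]; split; rewrite -nualg_circ ?h1 ?h2 nualg0. Qed.

End nualg_morphism.

Section spectral.
Context {R : realType} {H : completeNormedModType R[i]} {A : frechetAlgType R}.
Context {j : A -> compop H} (jm : nualg_morphism j) (jc : continuous j)
  (js : spectral_invariant j).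

Lemma spectral_qinv a c : qinv (j a) c -> exists c', qinv a c'.
Proof. by move=> h; apply/quasi_invertibleP/js/quasi_invertibleP; exists c. Qed.

Lemma nbhs_norm_lt1 : nbhs (0 : A) [set a | `|j a| < 1].
Proof.
have : nbhs (j 0) [set k : compop H | `|k| < 1].
  rewrite nualg0//; apply/nbhs_ballP; exists 1 => //= k.
  by rewrite -ball_normE /= sub0r normrN.
exact: jc.
Qed.

Lemma norm_lt1_qinv a : `|j a| < 1 -> exists c, qinv a c.
Proof. by move=> /neumann[c ac _]; exact: spectral_qinv ac. Qed.

Lemma cvg_norm_small (p : nat -> A) (P : A) (e : R[i]) : p @ \oo --> P -> 0 < e ->
  exists N, forall n, (N <= n)%N -> `|j (p n) - j P| < e.
Proof.
move=> pP e0; have jP := @jc P; have /cvgrPdist_lt/(_ _ e0) h := jP.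
have [N _ hN] := pP _ h.
by exists N => n Nn; rewrite distrC; exact: (hN n Nn).
Qed.

End spectral.

(** * Riesz projections of an element close to a multiple of a rank one projection *)

Section riesz_projection.
Context {R : realType} {H : completeNormedModType R[i]}
  {dot : {dot H for @Num.conj R[i]}} (H_hilbert : hilbert_norm dot).
Context {A : frechetAlgType R} {j : A -> compop H} (jm : nualg_morphism j)
  (jc : continuous j) (js : spectral_invariant j) (jd : dense (range j)).
Variables (v : H) (v1 : `|v| = 1).

Let p0 := rank1 H_hilbert v v.

Let dotvv : dot v v = 1. Proof. by rewrite -H_hilbert v1 expr1n. Qed.

Lemma rank1_idem : p0 ** p0 = p0.
Proof. by rewrite mul_rank1 rank1E dotvv scale1r. Qed.

Lemma norm_rank1_le1 : `|p0| <= 1.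
Proof. by rewrite (le_trans (norm_rank1 _ _ _))// v1 mulr1. Qed.

Lemma qinv_rank1 (z : R[i]) : z != 1 -> qinv (z *: p0) ((z / (z - 1)) *: p0).
Proof.
move=> z1; have z10 : z - 1 != 0 by rewrite subr_eq0.
by apply: mul_qinv; rewrite numulZl numulZr rank1_idem scalerA -scalerDl;
  congr (_ *: _); field.
Qed.

(** The factor 4 keeps the circles of radius 1 and 1/2 away from the pole [t = 1/4]: there
    [|4 t - 1| >= 1] and [|4 t| <= 4]. The bound 5 is the [M] fed to [qinv_perturb]. *)
Lemma norm_resolvent_coef (t : R[i]) : 2^-1 <= `|t| -> `|t| <= 1 ->
  t * 4 != 1 /\ 1 + `|(t * 4 / (t * 4 - 1)) *: p0| <= 5.
Proof.
move=> t1 t2.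
have n4 : `|t * 4| = `|t| * 4 by rewrite normrM [`|4|]ger0_norm.
have h1 : 1 <= `|t * 4 - 1|.
  apply: le_trans (lerB_dist _ _); rewrite normr1 n4 lerBrDr.
  apply: le_trans (_ : 2^-1 * 4 <= _); last by rewrite ler_pM2r.
  by rewrite (_ : 2^-1 * 4 = 1 + 1 :> R[i])//; field.
split.
  by apply/eqP => e; move: h1; rewrite e subrr normr0 ler10.
have -> : 5 = 1 + 4 :> R[i] by ring.
rewrite lerD2l normrZ; apply: le_trans (ler_piMr _ norm_rank1_le1) _ => //.
rewrite normrM normfV n4 ler_pdivrMr; last exact: lt_le_trans h1.
by apply: (@le_trans _ _ 4); [rewrite ler_piMl|rewrite ler_peMr].
Qed.

Lemma iter_nusqr_rank1 (z : R[i]) m :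
  iter m (@nusqr _ _) (z *: p0) = z ^+ (2 ^ m) *: p0.
Proof.
elim: m => [|m IH]; first by rewrite expr1.
by rewrite iterS IH /nusqr numulZl numulZr rank1_idem scalerA -exprD addnn -mul2n -expnS.
Qed.

(** [P] is the Riesz projection of [b] for the eigenvalues of modulus above [rho^-1]. The resolvents
    of [b] and [4 p0] stay within [5/24 <= 1/4] of each other by [qinv_perturb] with [M = 5] and
    [d = 1/125], hence so do their means, and those of [4 p0] are explicit. The final estimate is
    [1/4 + 1/3] plus a limit error below [1/12]. *)
Lemma riesz_limit (b : A) (rho : R[i]) : `|j b - 4 *: p0| <= 125^-1 ->
  2^-1 <= rho -> rho <= 1 ->
  exists p P, [/\ p @ \oo --> P,
    forall m, qinv (rho ^+ (2 ^ m) *: iter m (@nusqr _ _) b) (p m) & `|j P - p0| < 1].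
Proof.
move=> bp0 rho1 rho2.
have rho0 : 0 <= rho by apply: le_trans rho1; rewrite invr_ge0.
have nt y : `|rho * expi y| = rho by rewrite normrM normr_expi mulr1 ger0_norm.
pose c0 y := (rho * expi y * 4 / (rho * expi y * 4 - 1)) *: p0.
have t4 y : rho * expi y * 4 != 1 /\ 1 + `|c0 y| <= 5.
  by apply: norm_resolvent_coef; rewrite nt.
have c0P y : qinv ((rho * expi y) *: (4 *: p0)) (c0 y).
  by rewrite scalerA; apply: qinv_rank1; have [] := t4 y.
have QP y : exists q, qinv ((rho * expi y) *: b) q /\ `|j q - c0 y| <= 4^-1.
  have dx : `|j ((rho * expi y) *: b) - (rho * expi y) *: (4 *: p0)| <= 125^-1.
    rewrite nualgZ// -scalerBr normrZ nt; apply: le_trans bp0.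
    by rewrite ler_piMl.
  have [] := qinv_perturb (c0P y) (proj2 (t4 y)) dx.
    rewrite ltr_pdivrMr ?ltr0n// mul1r ltr_nat//.
  move=> c' jc' c'b; have [q bq] := spectral_qinv js jc'.
  exists q; split => //.
  have -> : j q = c' by apply: qinv_uniq (proj2 (nualg_qinv jm bq)) (proj1 jc').
  apply: le_trans c'b _.
  have -> : 5 ^+ 2 * 125^-1 / (1 - 5 * 125^-1) = 5 / 24 :> R[i] by field.
  by rewrite ler_pdivrMr ?ltr0n// ler_pdivlMl ?ltr0n// -natrM ler_nat.
have [Q QQ] := choice QP.
have bQ y : qinv ((rho * expi y) *: b) (Q y) by have [] := QQ y.
have cQ := resolvent_continuous (nbhs_norm_lt1 jm jc) (norm_lt1_qinv js) bQ.
have [P pP] := dyad_cvg (mulrn_wge0 2 (pi_ge0 R)) cQ.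
exists (fun m => dyad Q m 0 (pi *+ 2)), P; split => //.
  move=> m; have := dyad_qinv m 0 bQ.
  by rewrite {1}/expi cos0 sin0 mulr1.
have near0 m : `|dyad (j \o Q) m 0 (pi *+ 2) - dyad c0 m 0 (pi *+ 2)| <= 4^-1.
  rewrite -dyadB; apply: (@dyad_midconvex _ _ [set k : compop H | `|k| <= 4^-1]).
  - move=> k k' /= h h'; rewrite normrZ ger0_norm ?invr_ge0//.
    rewrite ler_pdivrMl ?ltr0n//; apply: le_trans (ler_normD _ _) _.
    by rewrite mulr_natl mulr2n lerD.
  - by rewrite mulrn_wge0// pi_ge0.
  - by move=> y _ /=; have [] := QQ y.
pose w m := (rho * 4) ^+ (2 ^ m).
(* As [rho * 4 >= 2], one squaring suffices; this is why [m = 0] is excluded and [N.+1] is used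
   below. *)
have wge m : (0 < m)%N -> 4 <= w m.
  move=> m0; apply: le_trans (_ : 2 ^+ (2 ^ m) <= _).
    apply: le_trans (_ : 2 ^+ (2 ^ 1) <= _); first by rewrite -natrX ler_nat.
    by rewrite -!natrX ler_nat !leq_exp2l.
  rewrite lerXn2r ?nnegrE//; first by rewrite mulr_ge0.
  by rewrite -ler_pdivrMr ?ltr0n//; have -> : 2 / 4 = 2^-1 :> R[i] by field.
have dc0 m : (0 < m)%N -> `|dyad c0 m 0 (pi *+ 2) - p0| <= 3^-1.
  move=> m0; have w4 := wge m m0.
  have w3 : 3 <= w m - 1 by rewrite lerBrDr; have -> : 3 + 1 = 4 :> R[i] by ring.
  have wn1 : w m - 1 != 0 by rewrite gt_eqF// (lt_le_trans _ w3)// ltr0n.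
  (* The mean is evaluated exactly, as the quasi-inverse of [w m *: p0], which is
     [w m / (w m - 1) *: p0]. *)
  have := dyad_qinv m 0 c0P.
  rewrite {1}/expi cos0 sin0 mulr1 iter_nusqr_rank1 scalerA -exprMn -/(w m).
  have wq : qinv (w m *: p0) ((w m / (w m - 1)) *: p0).
    by apply: qinv_rank1; rewrite -subr_eq0.
  move=> cq; rewrite -(qinv_uniq (proj2 wq) (proj1 cq)).
  have -> : (w m / (w m - 1)) *: p0 - p0 = (w m - 1)^-1 *: p0.
    by rewrite -[X in _ - X]scale1r -scalerBl; congr (_ *: _); field.
  rewrite normrZ normfV ger0_norm; last by rewrite (le_trans _ w3).
  apply: le_trans (ler_piMr _ norm_rank1_le1) _; first by rewrite invr_ge0 (le_trans _ w3).
  by rewrite lef_pV2 ?posrE// (lt_le_trans _ w3)// ltr0n.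
have e0 : 0 < 12^-1 :> R[i] by rewrite invr_gt0 ltr0n.
have [N hN] := cvg_norm_small jc pP e0.
have := hN N.+1 (leqnSn N); rewrite (@dyad_linear _ _ _ j); last exact: jm.1.
set X := dyad (j \o Q) _ _ _ => hX.
have -> : j P - p0 = (X - dyad c0 N.+1 0 (pi *+ 2)) + (dyad c0 N.+1 0 (pi *+ 2) - p0) - (X - j P).
  by rewrite addrA subrK opprB [RHS]addrC addrA subrK.
apply: le_lt_trans (ler_normB _ _) _.
have -> : 1 = 4^-1 + 3^-1 + 5 / 12 :> R[i] by field.
apply: ler_ltD; first by apply: le_trans (ler_normD _ _) (lerD (near0 _) (dc0 _ _)).
apply: lt_trans hX _.
by rewrite ltr_pdivlMr ?ltr0n// mulVf ?pnatr_eq0// ltr1n.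
Qed.

(* The limits P and P' of the means over the circles of radius 1 and 1/2 (in the variable
   t of [1 / (1 - t b)]) satisfy [P' = P P'], so P fixes the range of P'; being within
   distance less than 1 of P, the projection [p0] is injective on that range. *)
Lemma exists_rank1 : exists r u w x0,
  [/\ u != 0, j r x0 = u & forall x, j r x = dot (j r x) w *: u].
Proof.
have [a ap0] : exists a, `|j a - p0| < 500^-1.
  have e0 : 0 < 500^-1 :> R[i] by rewrite invr_gt0 ltr0n.
  have ne : ball p0 (500^-1 : R[i]) !=set0 by exists p0; exact: ballxx.
  have [k [/= kp0 [a _ ak]]] := jd ne (ball_open _ _).
  by exists a; rewrite ak distrC; rewrite -ball_normE in kp0.
pose b := 4 *: a.
have bp0 : `|j b - 4 *: p0| <= 125^-1.
  rewrite nualgZ// -scalerBr normrZ ger0_norm ?ler0n// -ler_pdivlMl ?ltr0n//.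
  by have -> : 4^-1 * 125^-1 = 500^-1 :> R[i] by [field]; exact: ltW.
have h2 : 2^-1 <= 1 :> R[i] by rewrite invf_le1 ?ltr0n// ler1n.
have [p [P [pP pq jPp0]]] := riesz_limit bp0 h2 (lexx 1).
have [p' [P' [pP' pq' jPp0']]] := riesz_limit bp0 (lexx _) h2.
have k0 : (fun m => (2^-1 : R[i]^o) ^+ (2 ^ m)) @ \oo --> (0 : R[i]^o).
  apply/cvgrPdist_lt => e e0.
  have half0 : 0 <= 2^-1 :> R by rewrite invr_ge0.
  have half1 : 2^-1 < 1 :> R by rewrite invf_lt1 ?ltr0n// ltr1n.
  have [N hN] := exprC_small half0 half1 (ler01 : 0 <= 1 :> R[i]) e0.
  exists N => // n /= Nn; rewrite sub0r normrN ger0_norm ?exprn_ge0 ?invr_ge0//.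
  apply: le_lt_trans hN; rewrite mulr1 fmorphV rmorph_nat.
  by rewrite ler_wiXn2l ?invr_ge0// (leq_trans Nn)// ltnW// ltn_expl.
have P'E : P' = P ** P'.
  have cpp' : (fun m => p m ** p' m) @ \oo --> P ** P'.
    apply: (@continuous2_cvg _ _ _ _ _ _ p p' (fun x y : A => x ** y)) => //.
    exact: (@frechet_mul_continuous _ A (P, P')).
  have cvgB' (f g : nat -> A) a1 a2 : f @ \oo --> a1 -> g @ \oo --> a2 ->
      (fun m => f m - g m) @ \oo --> a1 - a2.
    move=> fa ga; apply: (@continuous2_cvg _ _ _ _ _ _ f g (fun x y : A => x - y)) => //.
    exact: (@tvs.sub_continuous A (a1, a2)).
  have cl : (fun m => p' m - p m ** p' m) @ \oo --> P' - P ** P' by exact: cvgB'.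
  have cr : (fun m => ((2^-1 : R[i]^o) ^+ (2 ^ m)) *: (p m - p m ** p' m)) @ \oo
      --> 0 *: (P - P ** P').
    apply: (@continuous2_cvg _ _ _ _ _ _ (fun m => (2^-1 : R[i]^o) ^+ (2 ^ m) : R[i]^o)
       (fun m => p m - p m ** p' m) (fun (k : R[i]^o) (x : A) => k *: x) 0 (P - P ** P')) => //.
    - exact: (@scale_continuous _ _ ((0 : R[i]^o), P - P ** P')).
    - exact: cvgB'.
  (* Both are quasi-inverses of multiples of the same [b^(2^m)], with ratio [2^-(2^m)] tending to 0,
     while the bracket on the right converges. *)
  have E : (fun m => p' m - p m ** p' m) =
           (fun m => ((2^-1 : R[i]^o) ^+ (2 ^ m)) *: (p m - p m ** p' m)).
    apply/funext => m; apply: qinv_scale_commute (pq' m).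
    by have := pq m; rewrite expr1n scale1r.
  rewrite E in cl; have := cvg_seq_unique cl cr.
  by rewrite scale0r => /eqP; rewrite subr_eq0 => /eqP.
have lt1_eq0 (x : H) (c : R[i]) : c < 1 -> `|x| <= c * `|x| -> x = 0.
  move=> c1; apply: contra_leP => /eqP x0.
  by rewrite gtr_pMl// normr_gt0.
have inj x : dot (j P' x) v = 0 -> j P' x = 0.
  move=> x0; apply: (lt1_eq0 _ _ jPp0).
  have {1}-> : j P' x = (j P - p0) (j P' x); last exact: compop_normP.
  have -> : (j P - p0) (j P' x) = j P (j P' x) - p0 (j P' x) by [].
  by rewrite rank1E x0 scale0r subr0 -mul_compopE -jm.2 -P'E.
pose u := j P' v; pose al := dot u v.
have u0 : u != 0.
  apply/eqP => u0; have : v = 0.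
    apply: (lt1_eq0 _ _ jPp0').
    have := compop_normP (j P' - p0) v.
    have -> : (j P' - p0) v = j P' v - p0 v by [].
    by rewrite -/u u0 rank1E dotvv scale1r sub0r normrN.
  by move=> v0; move: v1; rewrite v0 normr0 => /eqP; rewrite eq_sym oner_eq0.
have al0 : al != 0 by apply: contra_neq u0 => /inj.
(* [dot] is conjugate linear on the right, so this makes [dot _ w] the functional [dot _ v / al],
   which is 1 at [u]. Both sides then lie in the range of [j P'] and have the same product with [v],
   so [inj] applies to their difference. *)
exists P', u, ((al^-1)^* *: v), v; split => // x.
rewrite linearZr_LR /= conjCK.
apply/eqP; rewrite -subr_eq0 -compopZ -compopB; apply/eqP/inj.
by rewrite compopB compopZ dotBl dotZl -/u -/al mulrAC mulVf// mul1r subrr.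
Qed.

End riesz_projection.


(** * Density of the ideal generated by a rank one element *)
Section rank1_ideal.
Context {R : realType} {H : completeNormedModType R[i]}
  {dot : {dot H for @Num.conj R[i]}} (H_hilbert : hilbert_norm dot).
Context {A : nuAlgType R[i]} {j : A -> compop H} (jm : nualg_morphism j)
  (jd : dense (range j)).
Implicit Types (k T S : compop H) (X Y : set A).

Lemma dense_norm_approx k (e : R[i]) : 0 < e -> exists a, `|j a - k| < e.
Proof.
move=> e0; have ne : ball k e !=set0 by exists k; exact: ballxx.
have [k' [/= kk' [a _ ak']]] := jd ne (ball_open _ _).
by exists a; rewrite ak' distrC; rewrite -ball_normE in kk'.
Qed.

Definition norm_approx X k := forall e : R[i], 0 < e -> exists2 a, X a & `|j a - k| < e.

Lemma norm_approxD X k T : (forall a b, X a -> X b -> X (a + b)) ->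
  norm_approx X k -> norm_approx X T -> norm_approx X (k + T).
Proof.
move=> XD Xk XT e e0; have e2 : 0 < e / 2 by rewrite divr_gt0.
have [a Xa ak] := Xk _ e2; have [b Xb bT] := XT _ e2.
exists (a + b); first exact: XD.
rewrite nualgD// opprD addrACA [e]splitr.
by apply: le_lt_trans (ler_normD _ _) _; exact: ltrD.
Qed.

Lemma mulr_lt_of_lt_div (a x e : R[i]) : 0 <= a -> 0 <= x -> x < e / (a + 1) -> a * x < e.
Proof.
move=> a0 x0; rewrite ltr_pdivlMr ?ltr_wpDl// mulrC; apply: le_lt_trans.
by rewrite ler_wpM2r// lerDl.
Qed.

Lemma norm_approx_mull X Y k T : (forall a c, X a -> Y (c ** a)) ->
  norm_approx X k -> norm_approx Y (T ** k).
Proof.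
move=> XY Xk e e0; have e2 : 0 < e / 2 by rewrite divr_gt0.
have T0 : 0 < `|T| + 1 by rewrite ltr_wpDl.
have [a Xa ak] := Xk _ (divr_gt0 e2 T0).
have a0 : 0 < `|j a| + 1 by rewrite ltr_wpDl.
(* [c] is chosen after [a], because its error gets multiplied by the norm of [j a]. *)
have [c cT] := @dense_norm_approx T _ (divr_gt0 e2 a0).
exists (c ** a); first exact: XY.
have -> : j (c ** a) - T ** k = (j c - T) ** j a + T ** (j a - k).
  by rewrite jm.2 numulBl numulBr addrA subrK.
rewrite [e]splitr; apply: le_lt_trans (ler_normD _ _) _; apply: ltrD.
  apply: le_lt_trans (compop_norm_mul _ _) _; rewrite mulrC.
  by apply: mulr_lt_of_lt_div.
by apply: le_lt_trans (compop_norm_mul _ _) _; apply: mulr_lt_of_lt_div.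
Qed.

Lemma norm_approx_mulr X Y k T : (forall a c, X a -> Y (a ** c)) ->
  norm_approx X k -> norm_approx Y (k ** T).
Proof.
move=> XY Xk e e0; have e2 : 0 < e / 2 by rewrite divr_gt0.
have T0 : 0 < `|T| + 1 by rewrite ltr_wpDl.
have [a Xa ak] := Xk _ (divr_gt0 e2 T0).
have a0 : 0 < `|j a| + 1 by rewrite ltr_wpDl.
have [c cT] := @dense_norm_approx T _ (divr_gt0 e2 a0).
exists (a ** c); first exact: XY.
have -> : j (a ** c) - k ** T = j a ** (j c - T) + (j a - k) ** T.
  by rewrite jm.2 numulBl numulBr addrA subrK.
rewrite [e]splitr; apply: le_lt_trans (ler_normD _ _) _; apply: ltrD.
  by apply: le_lt_trans (compop_norm_mul _ _) _; apply: mulr_lt_of_lt_div.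
apply: le_lt_trans (compop_norm_mul _ _) _; rewrite mulrC.
by apply: mulr_lt_of_lt_div.
Qed.

(* Greedy approximation: while T is not small, remove from its range the direction of
   some [T x] with [`|x| <= 1] and [`|T x|] not small. The chosen vectors have uniformly
   separated images under k, so by compactness this stops. *)
Lemma norm_approx_compact X : (forall a b, X a -> X b -> X (a + b)) -> X 0 ->
  (forall a c, X a -> X (a ** c)) -> (forall y z, norm_approx X (rank1 H_hilbert y z)) ->
  forall k, norm_approx X k.
Proof.
move=> XD X0 XM X1 k; apply: contrapT => notXk.
have [d d0 dP] : exists2 d : R, 0 < d & forall T, norm_approx X (k - T) -> d <= opnorm T.
  have [e [e0 eP]] : exists e : R[i], 0 < e /\ forall a, X a -> ~ (`|j a - k| < e).
    apply: contrapT => h; apply: notXk => e e0; apply: contrapT => h'.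
    by apply: h; exists e; split => // a Xa ak; apply: h'; exists a.
  have [r r0 er] := posC_Re e0; exists (r / 2); first by rewrite divr_gt0.
  move=> T XT; rewrite leNgt; apply/negP => Tr.
  have [a Xa ak] := XT _ (divr_gt0 e0 (ltr0n _ 2)).
  apply: (eP a Xa).
  have -> : j a - k = (j a - (k - T)) - T by rewrite opprB addrA addrAC addrK.
  rewrite [e]splitr; apply: le_lt_trans (ler_normB _ _) _; apply: ltrD => //.
  by rewrite compop_normE er -(rmorph_nat (real_complex R) 2) -fmorphV -rmorphM ltcR.
pose Good T := norm_approx X (k - T).
have pickx T : exists x, Good T -> `|x| <= 1 /\ (d / 2)%:C <= `|T x|.
  apply: contrapT => h.
  have GT : Good T by apply: contrapT => h'; apply: h; exists 0.
  have : opnorm T <= d / 2.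
    apply: opnorm_le => x x1; rewrite [`|T x|]Defs.normcE lecR leNgt; apply/negP => hx.
    by apply: h; exists x => _; split => //; rewrite [`|T x|]Defs.normcE lecR ltW.
  move=> /(le_trans (dP _ GT)); apply/negP; rewrite -ltNge ltr_pdivrMr//.
  by rewrite ltr_pMr// ltr1n.
have [x xP] := choice pickx.
pose v T := `|T (x T)|^-1 *: T (x T).
pose next T := T - rank1 H_hilbert (v T) (v T) ** T.
pose T n := iter n next k.
have GoodT n : Good (T n).
  elim: n => [|n IH]; rewrite /Good.
    by rewrite subrr => e e0; exists 0 => //; rewrite nualg0// subrr normr0.
  have -> : k - T n.+1 = (k - T n) + rank1 H_hilbert (v (T n)) (v (T n)) ** T n.
    by rewrite /= /next opprB addrA addrAC.
  by apply: norm_approxD => //; apply: (@norm_approx_mulr X).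
have dC : 0 < (d / 2)%:C by rewrite ltcR divr_gt0.
have Tx0 n : T n (x (T n)) != 0.
  by rewrite -normr_gt0; apply: lt_le_trans dC _; have [] := xP _ (GoodT n).
have nextE n y : T n.+1 y = T n y - dot (T n y) (v (T n)) *: v (T n) by [].
have v1 n : `|v (T n)| = 1 by exact: normfZV.
have Tdec n y : `|T n.+1 y| <= `|T n y|.
  by rewrite nextE; have [] := proj_norm_le H_hilbert (T n y) (v1 n).
have Tle n m y : (n <= m)%N -> `|T m y| <= `|T n y|.
  by move=> /subnK <-; elim: (m - n)%N => [//|i IH]; exact: le_trans (Tdec _ _) IH.
have T0 n m : (n < m)%N -> T m (x (T n)) = 0.
  move=> nm; apply/eqP; rewrite -normr_le0; apply: le_trans (Tle _ _ _ nm) _.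
  set z := T n (x (T n)); have nz : `|z| != 0 by rewrite normr_eq0 Tx0.
  have zE : z = `|z| *: v (T n) by rewrite /v -/z scalerA divff// scale1r.
  have vv : dot (v (T n)) (v (T n)) = 1 by rewrite -H_hilbert v1 expr1n.
  by rewrite nextE -/z [in dot z _]zE dotZl vv mulr1 -zE subrr normr0.
(* The norms of [T m y] decrease in [m] from [k = T 0], and [T m] kills [x (T n)]; what remains is
   the norm of [T m (x (T m))]. *)
have sep n m : (n < m)%N -> (d / 2)%:C <= `|k (x (T m)) - k (x (T n))|.
  move=> nm; rewrite -compopB; apply: le_trans (Tle 0%N m _ (leq0n m)).
  by rewrite compopB (T0 n m)// subr0; have [] := xP _ (GoodT m).
have [_ [C CP [cC _]]] := compopP k.
pose y n := k (x (T n)).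
have yC n : C (y n) by apply: CP; exists (x (T n)) => //; have [] := xP _ (GoodT n).
have [p [_ clp]] : C `&` cluster (y @ \oo) !=set0.
  by apply: cC; exists 0%N => // n _; exact: yC.
have d40 : 0 < (d / 4)%:C :> R[i] by rewrite ltcR divr_gt0.
have ybig N : (y @ \oo) [set z | exists2 n, (N <= n)%N & z = y n].
  by exists N => // n Nn; exists n.
have pnear : nbhs p (ball p (d / 4)%:C) by exact: nbhsx_ballx.
have [_ [[n _ ->] pn]] := clp _ _ (ybig 0%N) pnear.
have [_ [[m nm ->] pm]] := clp _ _ (ybig n.+1) pnear.
suff /(le_lt_trans (sep _ _ nm)) : `|y m - y n| < (d / 2)%:C by rewrite ltxx.
have -> : d / 2 = d / 4 + d / 4 by field.
rewrite rmorphD /= -(subrK p (y m)) -addrA.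
rewrite -ball_normE /= in pn pm.
by apply: le_lt_trans (ler_normD _ _) _; apply: ltrD => //; rewrite distrC.
Qed.

Definition two_sided (r : A) : set A :=
  [set a | exists s : seq (A * A), a = \sum_(p <- s) p.1 ** r ** p.2].

Lemma two_sidedD r a b : two_sided r a -> two_sided r b -> two_sided r (a + b).
Proof. by move=> [s ->] [t ->]; exists (s ++ t); rewrite big_cat. Qed.

Lemma two_sided0 r : two_sided r 0.
Proof. by exists [::]; rewrite big_nil. Qed.

Lemma two_sidedMr r a c : two_sided r a -> two_sided r (a ** c).
Proof.
move=> [s ->]; exists [seq (p.1, p.2 ** c) | p <- s].
by rewrite big_map numul_suml; apply: eq_bigr => p _ /=; rewrite !numulA.
Qed.

Lemma two_sidedMl r a c : two_sided r a -> two_sided r (c ** a).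
Proof.
move=> [s ->]; exists [seq (c ** p.1, p.2) | p <- s].
by rewrite big_map numul_sumr; apply: eq_bigr => p _ /=; rewrite !numulA.
Qed.

(** Every rank one operator factors through [j r]: send [z] to [x0], apply [j r] to reach [u], then
    send [u] to [y]. The outer factors are approximated from [A]. *)
Lemma two_sided_dense r u w x0 : u != 0 -> j r x0 = u ->
  (forall x, j r x = dot (j r x) w *: u) -> forall k, norm_approx (two_sided r) k.
Proof.
move=> u0 rx0 rE; apply: norm_approx_compact.
- exact: two_sidedD.
- exact: two_sided0.
- exact: two_sidedMr.
move=> y z; have uu0 : dot u u != 0 by apply: contra_neq u0; exact: dot_eq0.
have -> : rank1 H_hilbert y z =
    rank1 H_hilbert y (((dot u u)^-1)^* *: u) ** (j r ** rank1 H_hilbert x0 z).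
  rewrite !mul_rank1 rank1E rx0 linearZr_LR /= conjCK mulVf// scale1r.
  by [].
apply: (@norm_approx_mull [set a | exists d, a = r ** d]).
  by move=> _ c [d ->]; exists [:: (c, d)]; rewrite big_seq1 numulA.
apply: (@norm_approx_mulr [set r]); first by move=> _ c ->; exists c.
by move=> e e0; exists r => //; rewrite subrr normr0.
Qed.

End rank1_ideal.


(** * Modules *)
Section cyclic_module.
Context {R : realType} {A : frechetAlgType R} {E : completeNormedModType R[i]}
  (act : A -> E -> E).

Lemma closure_submodule (S : set E) : banach_module act -> submodule act S ->
  submodule act (closure S).
Proof.
move=> [[_ actl _] actc] [S0 SD SA].
have actca a : continuous (act a).
  move=> x; apply: (@continuous2_cvg _ _ _ _ _ _ (fun=> a) id act a x).
  - exact: (@actc (a, x)).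
  - exact: cvg_cst.
  - exact: cvg_id.
split; first exact: subset_closure.
  move=> k x y clx cly U nU.
  have cc : continuous (fun p : E * E => k *: p.1 + p.2).
    move=> p; apply: cvgD; last exact: cvg_snd.
    by apply: cvgZr; exact: cvg_fst.
  have [[U1 U2] /= [nU1 nU2] UU] := cc (x, y) _ nU.
  have [s [Ss U1s]] := clx _ nU1; have [t [St U2t]] := cly _ nU2.
  by exists (k *: s + t); split; [exact: SD|exact: (UU (s, t))].
move=> a x clx U nU; have [s [Ss Us]] := clx _ (actca a x _ nU).
by exists (act a s); split => //; exact: SA.
Qed.

End cyclic_module.

Section module_action.
Context {K : pzRingType} {A : nuAlgType K} {M : lmodType K} {act : A -> M -> M}
  (actP : module_action act).
Implicit Types (a b : A) (x y : M).

Lemma actDl a b x : act (a + b) x = act a x + act b x.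
Proof. by have [h _ _] := actP; have := h x 1 a b; rewrite !scale1r. Qed.

Lemma act0l x : act 0 x = 0.
Proof. by apply/(addrI (act 0 x)); rewrite -actDl !addr0. Qed.

Lemma actZl k a x : act (k *: a) x = k *: act a x.
Proof. by have [h _ _] := actP; have := h x k a 0; rewrite act0l !addr0. Qed.

Lemma actBl a b x : act (a - b) x = act a x - act b x.
Proof. by rewrite actDl -[- b]scaleN1r actZl scaleN1r. Qed.

Lemma actD a x y : act a (x + y) = act a x + act a y.
Proof. by have [_ h _] := actP; have := h a 1 x y; rewrite !scale1r. Qed.

Lemma act0 a : act a 0 = 0.
Proof. by apply/(addrI (act a 0)); rewrite -actD !addr0. Qed.

Lemma actZ k a x : act a (k *: x) = k *: act a x.
Proof. by have [_ h _] := actP; have := h a k x 0; rewrite act0 !addr0. Qed.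

Lemma actM a b x : act (a ** b) x = act a (act b x).
Proof. by have [_ _ h] := actP; exact: h. Qed.

Lemma act_sum (I : Type) (s : seq I) (F : I -> A) x :
  act (\sum_(i <- s) F i) x = \sum_(i <- s) act (F i) x.
Proof. by elim: s => [|i s IH]; rewrite ?big_nil ?act0l// !big_cons actDl IH. Qed.

End module_action.

Lemma compop_module_action (R : realType) (V : normedModType R[i]) :
  module_action (fun (k : compop V) (x : V) => k x).
Proof. by split=> [x a k l|k a x y|k l x] //; exact: compopD. Qed.

(* [compopZ] with the scaling of the conclusion inferred from the structure of H. *)
Lemma compop_scale (R : realType) (H : completeNormedModType R[i]) (T : compop H)
  (k : R[i]) (x y : H) : T x = y -> T (k *: x) = k *: y.
Proof. by move=> <-; exact: compopZ. Qed.

Section rank1_module.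
Context {R : realType} {H : completeNormedModType R[i]}
  {dot : {dot H for @Num.conj R[i]}} (H_hilbert : hilbert_norm dot).
Context {A : frechetAlgType R} {j : A -> compop H} (jm : nualg_morphism j)
  (ji : injective j) (js : spectral_invariant j)
  (jd : dense (range j)).
Context {E : completeNormedModType R[i]} {act : A -> E -> E}
  (actb : banach_module act) (acti : topologically_irreducible act).
Variables (r : A) (u w x0 : H) (u0 : u != 0) (rx0 : j r x0 = u)
  (rE : forall x, j r x = dot (j r x) w *: u).

Let actP : module_action act := proj1 actb.

Lemma rank1_sandwich a : r ** a ** r = dot (j r (j a u)) w *: r.
Proof.
apply: ji; apply/compop_eqP => x.
pose f := dot (j r x) w; have rx : j r x = f *: u by exact: rE.
transitivity ((f * dot (j r (j a u)) w) *: u).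
  rewrite -numulA !jm.2 !mul_compopE rx (compop_scale _ (erefl (j a u))).
  by rewrite (compop_scale _ (rE (j a u))) scalerA.
by rewrite mulrC -scalerA -rx nualgZ.
Qed.

Lemma rank1_act_range y0 : act r y0 != 0 ->
  forall x, exists k : R[i], act r x = k *: act r y0.
Proof.
set eta := act r y0 => eta0.
have rr : exists k : R[i], r ** r = k *: r.
  exists (dot (j r u) w); apply: ji; apply/compop_eqP => x.
  pose f := dot (j r x) w; have rx : j r x = f *: u by exact: rE.
  transitivity ((f * dot (j r u) w) *: u).
    by rewrite jm.2 mul_compopE rx (compop_scale _ (rE u)) scalerA.
  by rewrite mulrC -scalerA -rx nualgZ.
(* The line through [eta] is included because [A] may lack a unit and [eta] need not lie in [A eta].
   Irreducibility makes [S] dense, and [act r] maps it into a closed line. *)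
pose S := [set z | exists (k : R[i]) a, z = k *: eta + act a eta].
have subS : submodule act S.
  split.
  - by exists 0, 0; rewrite scale0r act0l// addr0.
  - move=> l _ _ [k [a ->]] [k' [a' ->]]; exists (l * k + k'), (l *: a + a').
    by rewrite scalerDl actDl// actZl// scalerDr scalerA addrACA.
  - move=> b _ [k [a ->]]; exists 0, (k *: b + b ** a).
    by rewrite scale0r add0r actD// actZ// actDl// actZl// actM.
have Seta : S eta by exists 1, 0; rewrite act0l// scale1r addr0.
have clT : closure S = setT.
  have [h|//] := acti.2 _ (closure_submodule actb subS) (@closed_closure _ S).
  by have : closure S eta; [exact: subset_closure|rewrite h => /= e0; rewrite e0 eqxx in eta0].
have rS z : S z -> exists k : R[i], act r z = k *: eta.
  move=> [k [a ->]]; have [l rrl] := rr.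
  exists (k * l + dot (j r (j a u)) w).
  have e1 : act r eta = l *: eta by rewrite -actZl// -rrl actM.
  have e2 : act r (act a eta) = dot (j r (j a u)) w *: eta.
    by rewrite -actZl// -rank1_sandwich !actM.
  by rewrite actD// actZ// e1 e2 scalerDl scalerA.
move=> x; have : closure S x by rewrite clT.
move=> clx.
have : closure [set k *: eta | k in [set: R[i]]] (act r x).
  move=> U nU.
  have ca : continuous (act r).
    move=> z; apply: (@continuous2_cvg _ _ _ _ _ _ (fun=> r) id act r z).
    - exact: (proj2 actb (r, z)).
    - exact: cvg_cst.
    - exact: cvg_id.
  have [s [/rS[k sk] Us]] := clx _ (ca x _ nU).
  by exists (act r s); split => //; exists k.
rewrite -(proj1 (closure_id _)); last exact: line_closed.
by move=> [k _ <-]; exists k.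
Qed.

(** If [j a u = 0] then [a ** r = 0] by injectivity of [j]. Conversely [a eta = 0] forces the
    functional [dot (j r _) w] to vanish on all [j d (j a u)]; were [j a u] nonzero, density would
    bring some [j d (j a u)] close to [x0], where the functional is 1. *)
Lemma rank1_act_eq0 y0 a : act r y0 != 0 -> act a (act r y0) = 0 <-> j a u = 0.
Proof.
move=> eta0; split=> [aeta|au]; last first.
  rewrite -actM//; have -> : a ** r = 0; last exact: act0l.
  apply: ji; apply/compop_eqP => x.
  by rewrite jm.2 mul_compopE (rE x) compopZ au scaler0 nualg0.
have fd d : dot (j r (j d (j a u))) w = 0.
  have : act (r ** (d ** a) ** r) y0 = 0 by rewrite !actM// aeta !act0.
  rewrite rank1_sandwich actZl// => /eqP; rewrite scaler_eq0 (negbTE eta0) orbF.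
  by rewrite jm.2 mul_compopE => /eqP.
apply/eqP; apply: contraT => z0; set z := j a u in z0 fd.
have zz0 : dot z z != 0 by apply: contra_neq z0; exact: dot_eq0.
pose k := rank1 H_hilbert x0 (((dot z z)^-1)^* *: z).
have kz : k z = x0 by rewrite rank1E linearZr_LR /= conjCK mulVf// scale1r.
have uw : dot u w = 1.
  have := rE x0; rewrite rx0 => /eqP; rewrite -subr_eq0 -{1}[u]scale1r -scalerBl.
  by rewrite scaler_eq0 (negbTE u0) orbF subr_eq0 eq_sym => /eqP.
pose q := `|j r| * `|z| * `|w|.
have q0 : 0 <= q by rewrite !mulr_ge0.
have q1 : 0 < q + 1 by rewrite ltr_wpDl.
have [d dk] := dense_norm_approx jd k (divr_gt0 ltr01 q1).
have h : `|dot (j r ((j d - k) z)) w| < 1.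
  apply: (@le_lt_trans _ _ (q * `|j d - k|)); last exact: mulr_lt_of_lt_div.
  apply: le_trans (cauchy_schwarz H_hilbert _ _) _.
  rewrite /q mulrAC ler_wpM2r// mulrAC -mulrA.
  apply: le_trans (compop_normP _ _) _; rewrite ler_wpM2l// .
  exact: compop_normP.
have E1 : (j d - k) z = j d z - k z by [].
move: h; rewrite E1 compopB dotBl fd kz rx0 uw sub0r normrN normr1.
by rewrite ltxx.
Qed.

Lemma rank1_cyclic_vector xi e : xi != 0 -> act e xi = xi ->
  exists c y0, act r y0 != 0 /\ xi = act c (act r y0).
Proof.
move=> xi0 exi.
have [rho rhoI rhoe] := two_sided_dense H_hilbert jm jd u0 rx0 rE (j e) ltr01.
have [c yc] : exists c, qinv (e - rho) c.
  by apply: (norm_lt1_qinv js); rewrite nualgB// distrC.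
(* This is [(1 - (e - rho))^-1 rho] written inside [A], and it stays in the ideal generated by
   [r]. *)
pose p := rho + - c ** rho.
have pI : two_sided r p by apply: two_sidedD => //; exact: two_sidedMl.
have pxi : act p xi = xi.
  have rhoxi : act rho xi = xi - act (e - rho) xi by rewrite actBl// exi opprB addrC subrK.
  have cxi : act c (act (e - rho) xi) = act (e - rho) xi + act c xi.
    by rewrite -actM// (qinv_mulr yc) actDl.
  rewrite /p numulNl actBl// actM// rhoxi.
  have -> : act c (xi - act (e - rho) xi) = act c xi - act c (act (e - rho) xi).
    by rewrite actD// -scaleN1r actZ// scaleN1r.
  by rewrite cxi opprB addrK subrK.
have [s ps] := pI.
have [y0 y00] : exists y0, act r y0 != 0.
  apply: contrapT => h; move/negP: xi0; apply; apply/eqP.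
  rewrite -pxi ps act_sum// big1_seq// => q _; rewrite !actM//.
  have -> : act r (act q.2 xi) = 0.
    by apply/eqP; apply: contrapT => /negP h'; apply: h; exists (act q.2 xi).
  exact: act0.
have [lam lamP] := choice (rank1_act_range y00).
(* Each [r b xi] is a multiple of [eta], so the sum of the [a r b xi] collapses to one element of
   [A] applied to [eta]. *)
exists (\sum_(q <- s) lam (act q.2 xi) *: q.1), y0; split => //.
rewrite -{1}pxi ps !act_sum//; apply: eq_bigr => q _.
by rewrite !actM// lamP actZ// actZl.
Qed.

End rank1_module.

Theorem theorem1p1 (R : realType) (H : completeNormedModType R[i])
  (dot : {dot H for @Num.conj R[i]})
  (H_hilbert : hilbert_norm dot)
  (H_infinite : ~ finite_dimensional H)
  (A : frechetAlgType R) (j : A -> compop H)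
  (A_dense : dense_frechet_subalgebra j)
  (A_spectral : spectral_invariant j)
  (E : completeNormedModType R[i]) (act : A -> E -> E)
  (E_banach : banach_module act)
  (E_irreducible : topologically_irreducible act)
  (F : set E)
  (F_submodule : submodule act F)
  (F_cyclic : algebraically_cyclic act F) :
  contained_in_module j act F.
Proof.
have [jm ji jc jd] := A_dense; have actP := proj1 E_banach.
have [xi Fxi FE] := F_cyclic.
exists H, (fun (k : compop H) (x : H) => k x).
have [h hP] : exists h, forall a, act a xi = 0 <-> j a h = 0.
  have [xi0|xi0] := eqVneq xi 0.
    by exists 0 => a; rewrite xi0 act0// compop0.
  have [v v1] : exists v : H, `|v| = 1.
    have [v0|] := pselect (exists v : H, v != 0).
      by have [v v0'] := v0; exists (`|v|^-1 *: v); exact: normfZV.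
    (* If every vector were 0, the empty family would span [H]. *)
    move=> h; case: H_infinite; exists 0%N, (fun=> 0) => x; exists (fun=> 0).
    by rewrite big_ord0; apply/eqP; apply: contrapT => /negP x0; apply: h; exists x.
  have [r [u [w [x0 [u0 rx0 rE]]]]] := exists_rank1 H_hilbert jm jc A_spectral jd v1.
  have [e exi] : exists e, act e xi = xi by move: Fxi; rewrite FE => -[e _ exi]; exists e.
  have [c [y0 [y00 ->]]] := rank1_cyclic_vector H_hilbert jm ji A_spectral jd E_banach
    E_irreducible u0 rx0 rE xi0 exi.
  exists (j c u) => a; have -> : j a (j c u) = j (a ** c) u by rewrite jm.2.
  rewrite -actM//.
  exact: (rank1_act_eq0 H_hilbert jm ji jd E_banach u0 rx0 rE).
have eqP a b : act a xi = act b xi <-> j a h = j b h.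
  have := hP (a - b); rewrite actBl// nualgB// -[(j a - j b) h]/(j a h - j b h) => -[h1 h2].
  by split=> /eqP; rewrite -subr_eq0 => /eqP; [move=> /h1|move=> /h2] => /eqP;
    rewrite subr_eq0 => /eqP.
(* The embedding is a function on all of [E]: a representative [a] is chosen for each [x] in [F],
   with default 0 elsewhere, and [eqP] makes the value independent of the choice. *)
have rep x : exists a, F x -> x = act a xi.
  have [Fx|] := pselect (F x); last by exists 0.
  by move: (Fx); rewrite FE => -[a _ <-]; exists a.
have [a aP] := choice rep.
have iotaE x b : F x -> x = act b xi -> j (a x) h = j b h.
  by move=> Fx xb; apply/eqP; rewrite -xb -aP.
have [F0 FD FA] := F_submodule.
exists (fun x => j (a x) h); split.
- exact: compop_module_action.
- move=> k x y Fx Fy; rewrite (iotaE _ (k *: a x + a y)).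
  + by rewrite nualgD// nualgZ.
  + exact: FD.
  + by rewrite actDl// actZl// -!aP.
- by move=> x y Fx Fy /eqP; rewrite -!aP.
- move=> b x Fx; rewrite (iotaE _ (b ** a x)).
  + by rewrite jm.2.
  + exact: FA.
  + by rewrite actM// -aP.
Qed.
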